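(* Let $f:\mathbb{R}^3\to[0,\infty)$ be a velocity probability density function, and suppose there are constants $c,k>0$ such that $f(\boldsymbol{v})\le c\,e^{-k v^2}$ for all $\boldsymbol{v}\in\mathbb{R}^3$, where $v=|\boldsymbol{v}|$. Suppose that the collision kernel is of the form $B(g,\chi)=g^{\lambda}\,\widetilde{B}$, where $\widetilde{B}$ is a positive constant and $0\le\lambda\le 1$. Let $g_{\mathrm{tr}}>0$, and let $Q=Q(f,f)$ and $Q^{\mathrm{tr}}=Q^{\mathrm{tr}}(f,f)$ be the Boltzmann collision operator and the truncated collision operator with truncation parameter $g_{\mathrm{tr}}$. Then for every $\boldsymbol{v}\in\mathbb{R}^3$ the truncation error $\mathcal{E}_{\mathrm{tr}}(\boldsymbol{v}):=|Q(\boldsymbol{v})-Q^{\mathrm{tr}}(\boldsymbol{v})|$ satisfies $$\mathcal{E}_{\mathrm{tr}}(\boldsymbol{v})\;\le\; c\,e^{-k v^2}\,\mathcal{E}_{\mathrm{rel}}(g_{\mathrm{tr}},v),$$ where $$\mathcal{E}_{\mathrm{rel}}(g_{\mathrm{tr}},v):=16\pi^2\,\widetilde{B}\,c\int_{g_{\mathrm{tr}}}^{\infty} e^{-k(v-g)^2}\left[\frac{1-e^{-4kvg}}{4kvg}\right]g^{\lambda+2}\,dg ,$$ and, when $v=0$, the bracketed factor is understood as its limiting value $1$.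
   Context: A velocity probability density function is a nonnegative measurable function $f$ on $\mathbb{R}^3$ with $\int_{\mathbb{R}^3} f=1$ (any time dependence is suppressed). The Boltzmann collision operator for elastic collisions between particles of the same species with unit mass is $$Q(\boldsymbol{v})=Q(f,f)(\boldsymbol{v})=\int_{\mathbb{R}^3}\int_{S^2}\left[f(\boldsymbol{v}')f(\boldsymbol{w}')-f(\boldsymbol{v})f(\boldsymbol{v}+\boldsymbol{g})\right]B\,d\Theta\,d\boldsymbol{g},$$ where $S^2$ is the unit sphere in $\mathbb{R}^3$ with surface measure $d\Theta$, $\boldsymbol{g}=\boldsymbol{w}-\boldsymbol{v}$ is the relative pre-collisional velocity, $g=|\boldsymbol{g}|$, and the post-collisional velocities are $$\boldsymbol{v}'=\boldsymbol{v}+\tfrac12(\boldsymbol{g}-g\,\Theta),\qquad \boldsymbol{w}'=\boldsymbol{w}-\tfrac12(\boldsymbol{g}-g\,\Theta),\qquad \boldsymbol{w}=\boldsymbol{v}+\boldsymbol{g}.$$ The collision kernel $B$ is in general a function of $g$ and of the scattering angle $\chi$ given by $\cos\chi=(\boldsymbol{g}\cdot\Theta)/g$; for a kernel of the form $B=g^{\lambda}\widetilde{B}$ with $\widetilde{B}$ constant it depends on $g$ only (isotropic collisions). The truncated collision operator $Q^{\mathrm{tr}}$ with truncation parameter $g_{\mathrm{tr}}$ is defined by the same formula with the $\boldsymbol{g}$-integral restricted to the ball $|\boldsymbol{g}|\le g_{\mathrm{tr}}$: $$Q^{\mathrm{tr}}(\boldsymbol{v})=Q^{\mathrm{tr}}(f,f)(\boldsymbol{v})=\int_{|\boldsymbol{g}|\le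 g_{\mathrm{tr}}}\int_{S^2}\left[f(\boldsymbol{v}')f(\boldsymbol{w}')-f(\boldsymbol{v})f(\boldsymbol{v}+\boldsymbol{g})\right]B\,d\Theta\,d\boldsymbol{g}.$$ *)

(* Defs.v *)
From HB Require Import structures.
From mathcomp Require Import all_boot all_order all_algebra.
From mathcomp Require Import all_classical all_reals all_analysis.
From mathcomp Require Import measurable_realfun.

Set Implicit Arguments.
Unset Strict Implicit.
Unset Printing Implicit Defensive.

Import Order.TTheory GRing.Theory Num.Theory.
Import numFieldNormedType.Exports.

Local Open Scope classical_set_scope.
Local Open Scope ring_scope.

(* R^3 with its Borel sigma-algebra and its componentwise vector operations.  The
   canonical norm of this product type is the sup norm, hence [norm3] below. *)
Notation vec3 R :=
  (measurableTypeR R * measurableTypeR R * measurableTypeR R)%type.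

Definition dot3 (R : realType) (x y : vec3 R) : R :=
  x.1.1 * y.1.1 + x.1.2 * y.1.2 + x.2 * y.2.

Definition norm3 (R : realType) (x : vec3 R) : R := Num.sqrt (dot3 x x).

Definition lebesgue3 (R : realType) : {measure set (vec3 R) -> \bar R} :=
  (@lebesgue_measure R \x @lebesgue_measure R \x @lebesgue_measure R)%E.

Definition sphere (R : realType) : set (vec3 R) := [set x | norm3 x = 1].

Definition spherical_coord (R : realType)
    (p : measurableTypeR R * measurableTypeR R) : vec3 R :=
  (sin p.1 * cos p.2, sin p.1 * sin p.2, cos p.1).

(* Surface measure of the unit sphere, as a Borel measure on R^3: the image under
   (theta, phi) |-> spherical_coord (theta, phi) of the area element
   sin theta dtheta dphi on [0, pi] x [0, 2 pi]. *)
Definition sphere_measure (R : realType) : set (vec3 R) -> \bar R := fun A =>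
  (\int[@lebesgue_measure R \x @lebesgue_measure R]_(p in
     (`[0%R, pi] `*` `[0%R, (2 * pi)%R]) `&` (@spherical_coord R @^-1` A))
     (sin p.1)%:E)%E.

Section sphere_measure_is_measure.
Context (R : realType).

Lemma measurable_spherical_coord :
  measurable_fun [set: measurableTypeR R * measurableTypeR R]
    (@spherical_coord R).
Proof.
have ms : measurable_fun [set: R] (@sin R).
  by apply: continuous_measurable_fun; exact: continuous_sin.
have mc : measurable_fun [set: R] (@cos R).
  by apply: continuous_measurable_fun; exact: continuous_cos.
apply: measurable_fun_pair; [apply: measurable_fun_pair|].
- by apply: measurable_funM; apply: measurableT_comp.
- by apply: measurable_funM; apply: measurableT_comp.
- exact: measurableT_comp.
Qed.

Let D : set (measurableTypeR R * measurableTypeR R) :=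
  `[0%R, pi] `*` `[0%R, (2 * pi)%R].

Let sin_D p : D p -> 0 <= sin p.1 :> R.
Proof. by case=> /= p1 _; apply: sin_ge0_pi; move: p1; rewrite in_itv. Qed.

Let mD A : measurable A -> measurable (D `&` (@spherical_coord R @^-1` A)).
Proof.
move=> mA; apply: measurableI; first exact: measurableX.
by rewrite -[X in measurable X]setTI; exact: measurable_spherical_coord.
Qed.

Let sphere_measure0 : @sphere_measure R set0 = 0%E.
Proof. by rewrite /sphere_measure preimage_set0 setI0 integral_set0. Qed.

Let sphere_measure_ge0 A : (0 <= @sphere_measure R A)%E.
Proof.
by apply: integral_ge0 => p [Dp _]; rewrite lee_fin; exact: sin_D.
Qed.

Let sphere_measure_sigma_additive : semi_sigma_additive (@sphere_measure R).
Proof.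
move=> F mF tF mUF; rewrite /sphere_measure preimage_bigcup setI_bigcupr.
rewrite ge0_integral_bigcup//=.
- by apply: is_cvg_ereal_nneg_natsum_cond => n _ _; exact: sphere_measure_ge0.
- by move=> n; exact: mD.
- apply: (@measurableT_comp _ _ _ _ _ _ EFin) => //.
  apply: measurableT_comp => //.
  + by apply: continuous_measurable_fun; exact: continuous_sin.
  + exact: measurable_funS measurable_fst.
- by move=> p [n _ [Dp _]]; rewrite lee_fin; exact: sin_D.
- apply/trivIsetP => i j _ _ ij; rewrite setIACA setIid -preimage_setI.
  by move/trivIsetP : tF => /(_ _ _ _ _ ij) ->//; rewrite preimage_set0 setI0.
Qed.

HB.instance Definition _ := isMeasure.Build _ _ _ (@sphere_measure R)
  sphere_measure0 sphere_measure_ge0 sphere_measure_sigma_additive.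

End sphere_measure_is_measure.

Definition velocity_pdf (R : realType) (f : vec3 R -> R) : Prop :=
  [/\ measurable_fun [set: vec3 R] f,
      forall v, 0 <= f v &
      (\int[lebesgue3 R]_v (f v)%:E = 1)%E].

Definition post_v (R : realType) (v g Theta : vec3 R) : vec3 R :=
  v + 2^-1 *: (g - norm3 g *: Theta).

Definition post_w (R : realType) (v g Theta : vec3 R) : vec3 R :=
  (v + g) - 2^-1 *: (g - norm3 g *: Theta).

(* At g = 0, where the angle is undefined, this is acos 0 = pi / 2; the value is
   immaterial since a single g is Lebesgue-negligible. *)
Definition scattering_angle (R : realType) (g Theta : vec3 R) : R :=
  acos (dot3 g Theta / norm3 g).

Section collision.
Context (R : realType) (B : R -> R -> R) (f : vec3 R -> R).

Definition collision_density (v g : vec3 R) : R :=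
  \int[@sphere_measure R]_(Theta in @sphere R)
    ((f (post_v v g Theta) * f (post_w v g Theta) - f v * f (v + g))
     * B (norm3 g) (scattering_angle g Theta)).

Definition collision_operator (v : vec3 R) : R :=
  \int[lebesgue3 R]_g collision_density v g.

Definition truncated_collision_operator (gtr : R) (v : vec3 R) : R :=
  \int[lebesgue3 R]_(g in [set g | norm3 g <= gtr]) collision_density v g.

End collision.

(* Here v and g are speeds; v stands for |v|. *)
Definition relative_truncation_error (R : realType) (Bt c k lambda gtr v : R)
    : R :=
  16 * pi ^+ 2 * Bt * c *
  \int[lebesgue_measure]_(g in `]gtr, +oo[)
    (expR (- (k * (v - g) ^+ 2))
     * (if v == 0 then 1
        else (1 - expR (- (4 * k * v * g))) / (4 * k * v * g))
     * g `^ (lambda + 2)).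

(* Main.v *)
(* The loss and gain terms of the integrand are both at most
   c^2 exp(-k (|v|^2 + |v+g|^2)), by conservation of energy, so the collision density
   at g is at most 4 pi Bt |g|^lambda times that.  The truncation error is the integral
   of the density over |g| > gtr, hence it remains to integrate
   exp(-k |v+g|^2) |g|^lambda = phi(|g|) psi(v.g) there.
   Rotation invariance of the Lebesgue measure (a plane rotation is a product of three
   shears) reduces to v = (0, 0, w).  For a fixed third coordinate z, the image of the
   plane Lebesgue measure under (x, y) |-> sqrt(x^2 + y^2 + z^2) is 2 pi r dr on
   [|z|, +oo[, because discs have area pi b^2; exchanging the integrals over z and r gives
   the integral of 2 pi r phi(r) times that of psi(w z) over -r <= z <= r, whose inner
   integral is elementary. *)
Require Import Defs.
From HB Require Import structures.
From mathcomp Require Import all_boot all_order all_algebra.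
From mathcomp Require Import all_classical all_reals all_analysis.
From mathcomp Require Import measurable_realfun ring lra.

Import Order.TTheory GRing.Theory Num.Theory.
Import numFieldNormedType.Exports.

Local Open Scope classical_set_scope.
Local Open Scope ring_scope.

(** * Rotations of the plane *)

Section rotation.
Context {R : realType}.
Local Notation mu := (@lebesgue_measure R).
Local Notation rT := (measurableTypeR R).
Local Open Scope ereal_scope.

(** Translating the end points of a bounded half-open interval preserves its length, and Lebesgue
    measure is determined by its values on such intervals. *)
Lemma lebesgue_measure_translation (a : R) (A : set rT) : measurable A ->
  pushforward mu ((fun x => x + a)%R : rT -> rT) A = mu A.
Proof.
move=> mA; apply/esym.
have ma : measurable_fun [set: rT] ((fun x => x + a)%R : rT -> rT).
  exact: measurable_funD.
apply: (@lebesgue_measure_unique R (pushforward mu ((fun x => x + a)%R : rT -> rT))) => //.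
move=> _ [[u v]] _ <-.
rewrite /pushforward/=.
rewrite [X in _ = mu X](_ : _ = `](u - a)%R, (v - a)%R]%classic); last first.
  by apply/seteqP; split => x /=; rewrite !in_itv/= ltrBlDr lerBrDr.
by rewrite !lebesgue_measure_itv/= !lte_fin ltrD2r -!EFinB opprB addrA subrK.
Qed.

Lemma ge0_integral_translation (a : R) (f : rT -> \bar R) :
  measurable_fun setT f -> (forall x, 0 <= f x) ->
  \int[mu]_x f (x + a)%R = \int[mu]_x f x.
Proof.
move=> mf f0.
have ma : measurable_fun [set: rT] ((fun x => x + a)%R : rT -> rT).
  exact: measurable_funD.
transitivity (\int[pushforward mu ((fun x => x + a)%R : rT -> rT)]_x f x).
  by rewrite (ge0_integral_pushforward ma).
by apply: eq_measure_integral => A mA _; exact: lebesgue_measure_translation.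
Qed.

Local Notation mu2 := (mu \x mu)%E.

(** For a fixed second coordinate the shear is a translation of the first one, so Tonelli with the
    first coordinate innermost suffices. *)
Lemma ge0_integral_shear1 (a : R) (F : rT * rT -> \bar R) :
  measurable_fun setT F -> (forall z, 0 <= F z) ->
  \int[mu2]_z F ((z.1 + a * z.2)%R, z.2) = \int[mu2]_z F z.
Proof.
move=> mF F0.
have mS : measurable_fun [set: rT * rT]
    ((fun z => ((z.1 + a * z.2)%R, z.2)) : rT * rT -> rT * rT).
  by apply: measurable_fun_pair => //; apply: measurable_funD => //; apply: measurable_funM.
rewrite fubini_tonelli2//; last exact: (measurableT_comp mF mS).
rewrite (fubini_tonelli2 F mF F0); apply: eq_integral => y _ /=.
rewrite /fubini_G/= (ge0_integral_translation _ (fun x => F (x, y)))//.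
exact: measurableT_comp.
Qed.

Lemma ge0_integral_shear2 (a : R) (F : rT * rT -> \bar R) :
  measurable_fun setT F -> (forall z, 0 <= F z) ->
  \int[mu2]_z F (z.1, (z.2 + a * z.1)%R) = \int[mu2]_z F z.
Proof.
move=> mF F0.
have mS : measurable_fun [set: rT * rT]
    ((fun z => (z.1, (z.2 + a * z.1)%R)) : rT * rT -> rT * rT).
  by apply: measurable_fun_pair => //; apply: measurable_funD => //; apply: measurable_funM.
rewrite fubini_tonelli1//; last exact: (measurableT_comp mF mS).
rewrite (fubini_tonelli1 F mF F0); apply: eq_integral => x _ /=.
rewrite /fubini_F/= (ge0_integral_translation _ (fun y => F (x, y)))//.
exact: measurableT_comp.
Qed.

Lemma measurable_rotation (c s : R) : measurable_fun [set: rT * rT]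
  ((fun z => ((c * z.1 - s * z.2)%R, (s * z.1 + c * z.2)%R)) : rT * rT -> rT * rT).
Proof.
apply: measurable_fun_pair.
  by apply: measurable_funB; apply: measurable_funM.
by apply: measurable_funD; apply: measurable_funM.
Qed.

Lemma ge0_integral_rotation (c s : R) (F : rT * rT -> \bar R) :
  measurable_fun setT F -> (forall z, 0 <= F z) -> (c ^+ 2 + s ^+ 2 = 1)%R ->
  \int[mu2]_z F ((c * z.1 - s * z.2)%R, (s * z.1 + c * z.2)%R) = \int[mu2]_z F z.
Proof.
(* A rotation with [s != 0] is a product of three shears; the half turn is the
   square of a quarter turn. *)
have main (c' s' : R) (G : rT * rT -> \bar R) : measurable_fun setT G ->
    (forall z, 0 <= G z) -> (c' ^+ 2 + s' ^+ 2 = 1)%R -> s' != 0%R ->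
    \int[mu2]_z G ((c' * z.1 - s' * z.2)%R, (s' * z.1 + c' * z.2)%R) =
    \int[mu2]_z G z.
  (* For the rotation of angle [theta], [a] is [- tan (theta / 2)]. The factors are the shear of the
     first coordinate by [a], that of the second by [s'], and that of the first by [a] again. *)
  move=> mG G0 cs s0; pose a := ((c' - 1) / s')%R.
  have mS1 : measurable_fun [set: rT * rT]
      ((fun z => ((z.1 + a * z.2)%R, z.2)) : rT * rT -> rT * rT).
    by apply: measurable_fun_pair => //; apply: measurable_funD => //; apply: measurable_funM.
  have mS2 : measurable_fun [set: rT * rT]
      ((fun z => (z.1, (z.2 + s' * z.1)%R)) : rT * rT -> rT * rT).
    by apply: measurable_fun_pair => //; apply: measurable_funD => //; apply: measurable_funM.
  rewrite -[RHS](ge0_integral_shear1 a)//.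
  rewrite -[RHS](ge0_integral_shear2 s' (fun z => G ((z.1 + a * z.2)%R, z.2)))//;
    last exact: (measurableT_comp mG mS1).
  rewrite -[RHS](ge0_integral_shear1 a (fun z => G ((z.1 + a * (z.2 + s' * z.1))%R,
    (z.2 + s' * z.1)%R)))//;
    last exact: (measurableT_comp mG (measurableT_comp mS1 mS2)).
  have as' : (a * s' = c' - 1)%R by rewrite mulfVK.
  have ac : (a * (1 + c') = - s')%R.
    apply: (mulIf s0); rewrite mulrAC as' mulNr -expr2.
    by rewrite -[in RHS](addKr (c' ^+ 2) (s' ^+ 2))%R cs; ring.
  have E1 (x y : R) :
      (c' * x - s' * y = x + a * y + a * (y + s' * (x + a * y)))%R.
    clearbody a; rewrite [RHS](_ : _ =
      (x + x * (a * s') + (2 * a + a * (a * s')) * y)%R); last by ring.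
    rewrite as' (_ : (2 * a + a * (c' - 1))%R = (a * (1 + c'))%R); last by ring.
    by rewrite ac; ring.
  have E2 (x y : R) : (s' * x + c' * y = y + s' * (x + a * y))%R.
    clearbody a; rewrite [RHS](_ : _ = (s' * x + (1 + a * s') * y)%R); last by ring.
    by rewrite as'; ring.
  by apply: eq_integral => -[x y] _; rewrite -[LHS]/(G (_, _)) E1 E2.
move=> mF F0 cs; have [s0|s0] := eqVneq s 0%R; last exact: main.
move: cs; rewrite s0 expr0n/= addr0 => /eqP; rewrite -subr_eq0 subr_sqr_1 mulf_eq0.
move=> /orP[|].
  rewrite subr_eq0 => /eqP ->; apply: eq_integral => -[x y] _ /=.
  by rewrite !mul1r !mul0r subr0 add0r.
rewrite addr_eq0 => /eqP ->.
have q : (0 ^+ 2 + 1 ^+ 2 = 1 :> R)%R by rewrite expr0n expr1n add0r.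
rewrite -[RHS](main 0%R 1%R)// -[RHS](main 0%R 1%R (fun z => F ((0 * z.1 - 1 * z.2)%R,
    (1 * z.1 + 0 * z.2)%R)))//; last exact: (measurableT_comp mF (measurable_rotation 0 1)).
have E1 (x y : R) : (- 1 * x - 0 * y = 0 * (0 * x - 1 * y) - 1 * (1 * x + 0 * y))%R.
  by ring.
have E2 (x y : R) : (0 * x + - 1 * y = 1 * (0 * x - 1 * y) + 0 * (1 * x + 0 * y))%R.
  by ring.
by apply: eq_integral => -[x y] _; rewrite -[LHS]/(F (_, _)) E1 E2.
Qed.

End rotation.

(** * Discs and spherical shells *)

Section disc.
Context {R : realType}.
Local Notation mu := (@lebesgue_measure R).
Local Notation rT := (measurableTypeR R).

Lemma integral_disc_chord (r : R) : 0 < r ->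
  (\int[mu]_(x in `[(- r)%R, r]) (2 * Num.sqrt (r ^+ 2 - x ^+ 2))%:E
   = (pi * r ^+ 2)%:E)%E.
Proof.
move=> r0.
pose s (x : R) : R := Num.sqrt (r ^+ 2 - x ^+ 2).
(* This is [x s + r^2 asin (x / r)], with [asin (x / r) = 2 atan (x / (r + s))] so that
   continuity at the end points is clear. *)
pose F (x : R) : R := x * s x + 2 * r ^+ 2 * atan (x * (r + s x)^-1).
have s0 x : 0 <= s x by exact: sqrtr_ge0.
have rs0 x : r + s x != 0 by rewrite gt_eqF// ltr_pwDl.
have cs : continuous s.
  move=> x; apply: continuous_comp; last exact: sqrt_continuous.
  by apply: continuousB; [exact: cst_continuous|exact: exprn_continuous].
have cF : continuous F.
  move=> x; have ci : {for x, continuous (fun x : R => x * (r + s x)^-1)}.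
    apply: continuousM => //; apply: continuousV => //.
    by apply: continuousD; [exact: cst_continuous|exact: cs].
  have ca : {for x, continuous (fun x : R => atan (x * (r + s x)^-1))}.
    apply: continuous_comp; first exact: ci.
    exact: continuous_atan.
  apply: (@continuousD _ R^o R (fun x : R => x * s x)).
    by apply: continuousM => //; exact: cs.
  by apply: continuousM; first exact: cst_continuous.
have dF x : x \in `]- r, r[ -> is_derive x 1 F (2 * s x).
  rewrite in_itv/= => /andP[rx xr].
  have p0 : 0 < r ^+ 2 - x ^+ 2 by nra.
  have sx0 : 0 < s x by rewrite sqrtr_gt0.
  have sE : s x ^+ 2 = r ^+ 2 - x ^+ 2 by rewrite sqr_sqrtr// ltW.
  have ds : is_derive x 1 s (- x / s x).
    have dq : is_derive x 1 (cst (r ^+ 2) - (@id R) ^+ 2) (0 - (2%:R * x ^+ 1) *: 1).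
      exact: is_deriveB.
    have := @is_derive1_comp _ Num.sqrt (cst (r ^+ 2) - (@id R) ^+ 2) x _ _ (is_derive1_sqrt p0) dq.
    rewrite (_ : _ * _ = - x / s x)//.
    rewrite -/(s x) /GRing.scale/=; move: (s x) sx0 => t t0; field.
    by rewrite gt_eqF.
  have dt : is_derive x 1 (cst r + s) (0 + - x / s x) by exact: is_deriveD.
  have dv := @is_deriveV _ (cst r + s) x _ 1 (rs0 x) dt.
  have du := is_deriveM (is_derive_id x 1) dv.
  have dat := @is_derive1_comp _ atan (@id R * (fun y => ((cst r + s) y)^-1)) x _ _
    (is_derive1_atan _) du.
  have dc := is_deriveM (is_derive_cst (2 * r ^+ 2) x 1) dat.
  apply: (is_derive_eq (is_deriveD (is_deriveM (is_derive_id x 1) ds) dc)).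
  rewrite /GRing.scale/= !fctE /cst /=.
  move: (s x) sx0 sE (rs0 x) => t t0 tE rt0.
  have rE : r ^+ 2 = t ^+ 2 + x ^+ 2 by rewrite tE subrK.
  (* Because [t ^+ 2 + x ^+ 2 = r ^+ 2], the denominator in the derivative of [atan] collapses. The
     second term of [F] then contributes [r ^+ 2 / t] and the first [t - x ^+ 2 / t], which add up
     to [2 * t]. *)
  have den : (r + t) ^+ 2 + x ^+ 2 = 2 * r * (r + t).
    have -> : (r + t) ^+ 2 + x ^+ 2 = r ^+ 2 + 2 * r * t + (t ^+ 2 + x ^+ 2) by ring.
    by rewrite -rE; ring.
  have rn0 : r != 0 by rewrite gt_eqF.
  have tn0 : t != 0 by rewrite gt_eqF.
  have -> : 1 + (x / (r + t)) ^+ 2 = 2 * r / (r + t).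
    have -> : 1 + (x / (r + t)) ^+ 2 = ((r + t) ^+ 2 + x ^+ 2) / (r + t) ^+ 2.
      by field; rewrite ?tn0 ?rt0 ?rn0.
    by rewrite den; field.
  rewrite mulr0 addr0 mulr1.
  have -> : x * (- (r + t) ^- 2 * (0 + - x / t)) + (r + t)^-1 * 1 =
      (t * r + (t ^+ 2 + x ^+ 2)) / (t * (r + t) ^+ 2).
    by field; rewrite ?tn0 ?rt0 ?rn0.
  rewrite -rE.
  have -> : 2 * r ^+ 2 * ((2 * r / (r + t))^-1 *
      ((t * r + r ^+ 2) / (t * (r + t) ^+ 2))) = r ^+ 2 / t.
    by field; rewrite ?tn0 ?rt0 ?rn0.
  by rewrite rE; field.
rewrite (@continuous_FTC2 _ (fun x => 2 * s x) F).
(* At the end points [s] vanishes and [atan] is evaluated at 1 and -1, which gives [pi / 4] and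
   [- pi / 4]. *)
- rewrite /F /s sqrrN subrr sqrtr0 !mulr0 !addr0 !add0r mulNr divff ?gt_eqF// atanN atan1 -EFinB.
  by congr EFin; field; lra.
- by lra.
- have c2 : continuous (fun x : R => 2 * s x : R).
    by move=> x; apply: cvgM; [exact: cvg_cst|exact: cs].
  exact: continuous_subspaceT.
- split; first by move=> x xr; case: (dF x xr).
    by apply: cvg_at_right_filter; exact: cF.
  by apply: cvg_at_left_filter; exact: cF.
- by move=> x xr; rewrite derive1E; case: (dF x xr).
Qed.

(** [b] is the squared radius, of either sign. The area is the integral of the chord lengths; as
    [Num.sqrt] vanishes on negative numbers, the same formula covers the empty slices. *)
Lemma disc_area (b : R) :
  (mu \x mu)%E [set z : rT * rT | z.1 ^+ 2 + z.2 ^+ 2 < b] = (pi * Num.max 0 b)%:E.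
Proof.
pose s (x : R) : R := Num.sqrt (b - x ^+ 2).
have sliceE (x : R) :
    mu (xsection [set z : rT * rT | z.1 ^+ 2 + z.2 ^+ 2 < b] x) = (2 * s x)%:E.
  have -> : xsection [set z : rT * rT | z.1 ^+ 2 + z.2 ^+ 2 < b] x =
      `](- s x), (s x)[%classic.
    apply/seteqP; split => y; rewrite /xsection/= inE/= in_itv/= -ltr_norml => xy.
      by rewrite -sqrtr_sqr ltr_sqrt; nra.
    have [p0|p0] := leP (b - x ^+ 2) 0.
      by move: xy; rewrite /s ler0_sqrtr// normr_lt0.
    by move: xy; rewrite -sqrtr_sqr ltr_sqrt//; lra.
  rewrite lebesgue_measure_itv/= lte_fin; case: ifPn => ss.
    by rewrite -EFinB; congr EFin; ring.
  have : 0 <= s x by exact: sqrtr_ge0.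
  by move=> ?; congr EFin; lra.
rewrite [LHS]/product_measure1/=; under eq_integral do rewrite sliceE.
have [b0|b0] := leP b 0.
  rewrite mulr0 integral0_eq// => x _; rewrite /s ler0_sqrtr ?mulr0//.
  by have := sqr_ge0 x; lra.
have bE : b = Num.sqrt b ^+ 2 by rewrite sqr_sqrtr// ltW.
rewrite [in RHS]bE -integral_disc_chord ?sqrtr_gt0// -bE [RHS]integral_mkcond.
apply: eq_integral => x _; rewrite patchE; case: ifPn => // /negP xb.
rewrite /s ler0_sqrtr ?mulr0//; have [//|bx] := leP (b - x ^+ 2) 0.
exfalso; apply: xb; rewrite inE/= in_itv/= -ler_norml -sqrtr_sqr ler_sqrt//.
  by lra.
exact: ltW.
Qed.

End disc.

(** * The distribution of the distance to the origin on a horizontal plane *)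

Section shell.
Context {R : realType}.
Local Notation mu := (@lebesgue_measure R).
Local Notation rT := (measurableTypeR R).
Local Open Scope ereal_scope.

Local Notation mu2 := (mu \x mu)%E.

Lemma ge0_integral_mrestr d (T : measurableType d) (m : {measure set T -> \bar R})
    (D : set T) (mD : measurable D) (f : T -> \bar R) :
  measurable_fun setT f -> (forall x, 0 <= f x) ->
  \int[mrestr m mD]_x f x = \int[m]_(x in D) f x.
Proof.
move=> mf f0.
rewrite (@ge0_negligible_integral _ _ _ _ setT (~` D))//; last 2 first.
- exact: measurableC.
- by rewrite /= /mrestr setICl.
rewrite setTD setCK; apply: eq_measure_integral => A mA AD.
by rewrite /= /mrestr setIidl.
Qed.

(** Open lower half-lines are stable under intersection and generate the Borel sets, and those with
    end points [n%:R] exhaust the line with finite measure. *)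
Lemma measure_unique_half_lines (m1 m2 : {measure set rT -> \bar R}) :
  (forall b, m1 `]-oo, b[%classic = m2 `]-oo, b[%classic) ->
  (forall b, m1 `]-oo, b[%classic < +oo) ->
  forall A, measurable A -> m1 A = m2 A.
Proof.
move=> m12 m1oo A mA.
apply: (@measure_unique _ R rT (@RGenInftyO.G R) (fun n => `]-oo, n%:R[%classic)) => //.
- exact: RGenInftyO.measurableE.
- move=> _ _ [x ->] [y ->]; exists (Num.min x y).
  by apply/seteqP; split => r /=; rewrite !in_itv/= lt_min => /andP.
- by move=> n; exists n%:R.
- apply/seteqP; split => // x _; exists (Num.trunc `|x|%R).+1 => //=.
  by rewrite in_itv/= (le_lt_trans (ler_norm x))// truncnS_gt.
- by move=> _ [x ->]; exact: m12.
Qed.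

Lemma measurable_set_bool d (T : measurableType d) (b : T -> bool) :
  measurable_fun setT b -> measurable [set x | b x].
Proof.
move=> mb; rewrite (_ : [set x | b x] = setT `&` b @^-1` [set true]); first exact: mb.
by rewrite setTI.
Qed.

(** The Euclidean norm of the point of the horizontal plane of height [z] that lies over [p]. *)
Definition shell_norm (z : R) (p : rT * rT) : rT :=
  Num.sqrt (p.1 ^+ 2 + p.2 ^+ 2 + z ^+ 2).

Lemma measurable_shell_norm z : measurable_fun setT (shell_norm z).
Proof.
have ms : measurable_fun [set: R] (@Num.sqrt R).
  by apply: continuous_measurable_fun; exact: sqrt_continuous.
have mq : measurable_fun setT (fun p : rT * rT => p.1 ^+ 2 + p.2 ^+ 2 + z ^+ 2 : R)%R.
  by apply: measurable_funD => //; apply: measurable_funD; apply: measurable_funX.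
exact: (measurableT_comp ms mq).
Qed.

(* The slice of this region over [r] has length [2 pi r], so the measure [2 pi r dr] on
   [[|z|, +oo[] is the image under [fst] of the plane measure restricted to it. *)
Definition wedge (z : R) : set (rT * rT) :=
  [set p | [&& `|z| <= p.1, 0 <= p.2 & p.2 <= 2 * pi * p.1]%R].

Lemma measurable_wedge z : measurable (wedge z).
Proof.
apply: measurable_set_bool; apply: measurable_and; last apply: measurable_and;
  by apply: measurable_fun_ler => //; exact: measurable_funM.
Qed.

Lemma mu_xsection_wedge z (A : set rT) (r : rT) :
  mu (xsection (wedge z `&` fst @^-1` A) r) =
  ((fun r => (2 * pi * r)%:E) \_ ([set r | `|z| <= r]%R `&` A)) r.
Proof.
rewrite patchE; case: ifPn => [|/negP] rA.
  move: rA; rewrite inE/= => -[zr Ar].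
  have -> : xsection (wedge z `&` fst @^-1` A) r = `[0%R, (2 * pi * r)%R]%classic.
    apply/seteqP; split => t; rewrite /xsection /wedge/= inE/= in_itv/=.
      by move=> [/and3P[_ -> ->]].
    by rewrite zr => ->.
  have r0 : (0 <= 2 * pi * r)%R.
    by rewrite mulr_ge0 ?mulr_ge0 ?pi_ge0// (le_trans _ zr).
  rewrite lebesgue_measure_itv/= lte_fin; case: ifPn => ss; first by rewrite sube0.
  by congr EFin; apply/eqP; rewrite eq_le r0 leNgt.
have -> : xsection (wedge z `&` fst @^-1` A) r = set0; last exact: measure0.
apply/seteqP; split => // t; rewrite /xsection /wedge/= inE/= => -[/and3P[zr _ _] Ar].
by apply: rA; rewrite inE.
Qed.

(** It suffices to compare both measures on half-lines []-oo, b[]. For [b] above [|z|], one gives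
    the area of the disc of squared radius [b ^+ 2 - z ^+ 2], the other the integral of [2 * pi * r]
    from [|z|] to [b]; both are [pi * (b ^+ 2 - z ^+ 2)]. Otherwise both vanish. *)
Lemma shell_distribution z (A : set rT) : measurable A ->
  mu2 (shell_norm z @^-1` A) = mu2 (wedge z `&` fst @^-1` A).
Proof.
have lt_half_line (b : R) :
    mu2 (shell_norm z @^-1` `]-oo, b[) = mu2 (wedge z `&` fst @^-1` `]-oo, b[).
  have -> : mu2 (wedge z `&` fst @^-1` `]-oo, b[) =
      \int[mu]_(r in `[`|z|%R, b[) (2 * pi * r)%:E.
    rewrite [LHS]/product_measure1/=; under eq_integral do rewrite mu_xsection_wedge.
    rewrite -integral_mkcond; congr (integral _ _ _).
    by apply/seteqP; split => r /=; rewrite !in_itv/= => /andP.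
  have [bz|zb] := leP b `|z|%R.
    rewrite [in RHS](@set_itv_ge _ _ (BLeft `|z|%R)) ?bnd_simp -?leNgt// integral_set0.
    have -> : shell_norm z @^-1` `]-oo, b[ = set0; last exact: measure0.
    apply/seteqP; split => // p /=; rewrite in_itv/= /shell_norm => pb.
    have : (Num.sqrt (z ^+ 2) <= Num.sqrt (p.1 ^+ 2 + p.2 ^+ 2 + z ^+ 2))%R.
      by rewrite ler_wsqrtr// lerDr addr_ge0 ?sqr_ge0.
    by rewrite sqrtr_sqr; lra.
  have b0 : (0 < b)%R by rewrite (le_lt_trans _ zb).
  have -> : shell_norm z @^-1` `]-oo, b[ =
      [set p : rT * rT | p.1 ^+ 2 + p.2 ^+ 2 < b ^+ 2 - z ^+ 2]%R.
    apply/seteqP; split => p /=; rewrite in_itv/= /shell_norm.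
      rewrite -[X in (_ < X)%R -> _](gtr0_norm b0) -sqrtr_sqr ltr_sqrt ?exprn_gt0//.
      by rewrite ltrBrDr.
    rewrite -[X in _ -> (_ < X)%R](gtr0_norm b0) -sqrtr_sqr ltr_sqrt ?exprn_gt0//.
    by rewrite ltrBrDr.
  rewrite disc_area max_r; last first.
    by rewrite subr_ge0 -(real_normK (num_real z)) ler_sqr ?nnegrE// ltW.
  have c2 : continuous (fun x : R => 2 * pi * x : R)%R.
    by move=> x; apply: cvgM; [exact: cvg_cst|exact: cvg_id].
  have cF : continuous (fun x : R => pi * x ^+ 2 : R)%R.
    by move=> x; apply: cvgM; [exact: cvg_cst|exact: exprn_continuous].
  have dF (x : R) : is_derive x 1%R (fun x : R => pi * x ^+ 2 : R)%R (2 * pi * x)%R.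
    apply: (is_derive_eq (is_deriveM (is_derive_cst pi x 1%R)
      (is_deriveX 2 (is_derive_id x 1%R)))).
    by rewrite /GRing.scale/= /cst/=; ring.
  rewrite integral_itv_bndo_bndc; last first.
    by apply/measurable_EFinP; apply: measurable_funM.
  rewrite (@continuous_FTC2 _ (fun x => 2 * pi * x)%R (fun x => pi * x ^+ 2)%R)//.
  - by rewrite -EFinB -mulrBr real_normK ?num_real.
  - exact: continuous_subspaceT.
  - split; first by move=> x _; case: (dF x).
      by apply: cvg_at_right_filter; exact: cF.
    by apply: cvg_at_left_filter; exact: cF.
  - by move=> x _; rewrite derive1E; case: (dF x).
have m2E B : pushforward (mrestr mu2 (measurable_wedge z)) (@fst rT rT) B =
    mu2 (wedge z `&` fst @^-1` B) by rewrite /pushforward /mrestr setIC.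
(* The measure structure of a pushforward takes the measurability of the map as argument,
   whence the two premises discharged first. *)
have := @measure_unique_half_lines (pushforward mu2 (shell_norm z))
  (pushforward (mrestr mu2 (measurable_wedge z)) (@fst rT rT)).
move=> /(_ (measurable_shell_norm z) (@measurable_fst _ _ rT rT)) uniq_m mA.
rewrite -m2E; apply: uniq_m mA => b; first by rewrite [RHS]m2E; exact: lt_half_line.
(* Finiteness on half-lines: the points with [shell_norm] below [b] lie in the disc of squared
   radius [b ^+ 2]. *)
rewrite (@le_lt_trans _ _ (pi * Num.max 0 (b ^+ 2))%:E)%E ?ltry// -disc_area.
have := @le_measure _ _ _ (mu \x mu)%E; apply; rewrite ?inE//.
- by rewrite -[X in measurable X]setTI; exact: measurable_shell_norm.
- apply: measurable_set_bool; apply: measurable_fun_ltr => //.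
  by apply: measurable_funD; apply: measurable_funX.
- move=> p /=; rewrite in_itv/= /shell_norm => pb.
  have b0 : (0 <= b)%R by rewrite (le_trans _ (ltW pb)) ?sqrtr_ge0.
  have : (p.1 ^+ 2 + p.2 ^+ 2 + z ^+ 2 < b ^+ 2)%R.
    by rewrite -ltr_sqrt ?sqrtr_sqr ?ger0_norm// exprn_gt0// (le_lt_trans _ pb) ?sqrtr_ge0.
  by apply: le_lt_trans; rewrite lerDl sqr_ge0.
Qed.

(** By [shell_distribution] the image of the plane measure may be replaced by that of the wedge
    under [fst]. Tonelli over the wedge then yields the weight [2 * pi * r], the length of its slice
    at [r]. *)
Lemma ge0_integral_shell z (H : rT -> \bar R) :
  measurable_fun setT H -> (forall r, 0 <= H r) ->
  \int[mu2]_p H (shell_norm z p) =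
  \int[mu]_(r in `[`|z|%R, +oo[) ((2 * pi * r)%:E * H r).
Proof.
move=> mH H0.
transitivity (\int[pushforward mu2 (shell_norm z)]_r H r).
  by rewrite (ge0_integral_pushforward (measurable_shell_norm z)).
transitivity (\int[pushforward (mrestr mu2 (measurable_wedge z)) (@fst rT rT)]_r H r).
  have := @eq_measure_integral _ rT R setT
    (pushforward (mrestr mu2 (measurable_wedge z)) (@fst rT rT))
    (pushforward mu2 (shell_norm z)) H.
  move=> /(_ (@measurable_fst _ _ rT rT) (measurable_shell_norm z)); apply => A mA _.
  transitivity (mu2 (shell_norm z @^-1` A)); first by [].
  by rewrite shell_distribution//; exact: (congr1 mu2 (setIC _ _)).
rewrite (ge0_integral_pushforward (@measurable_fst _ _ rT rT))//=.
rewrite ge0_integral_mrestr//; last exact: measurableT_comp.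
have mw := measurable_wedge z.
rewrite integral_mkcond fubini_tonelli1/=; last 2 first.
- by apply/(measurable_restrictT _ mw); apply: measurable_funTS; exact: measurableT_comp.
- by move=> p; apply: erestrict_ge0.
rewrite [RHS]integral_mkcond; apply: eq_integral => r _; rewrite /fubini_F.
rewrite (_ : (fun y => _) = (fun y => H r * (\1_(xsection (wedge z) r) y)%:E)); last first.
  apply/funext => y; rewrite patchE indicE mem_xsection/=.
  by case: ifPn => _; rewrite ?mule1 ?mule0.
rewrite ge0_integralZl//; last first.
  by apply/measurable_EFinP; apply: measurable_indic; exact: measurable_xsection.
rewrite integral_indic//; last exact: measurable_xsection.
rewrite setIT; transitivity (H r * mu (xsection (wedge z) r)); first by [].
have := mu_xsection_wedge z setT r; rewrite preimage_setT !setIT => ->.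
rewrite !patchE.
rewrite (_ : `[_, +oo[%classic = [set r : rT | `|z| <= r]%R).
  by case: ifPn => _; rewrite ?mule0// muleC.
by apply/seteqP; split => t /=; rewrite in_itv/= andbT.
Qed.

End shell.

(** * Spherical coordinates *)

Section measurable_vec3.
Context {R : realType}.
Local Notation rT := (measurableTypeR R).

Context d (T : measurableType d).
Implicit Types u v : T -> vec3 R.

Lemma measurable_vec3P u :
  [/\ measurable_fun setT (fun t => (u t).1.1), measurable_fun setT (fun t => (u t).1.2)
    & measurable_fun setT (fun t => (u t).2)] <-> measurable_fun setT u.
Proof.
split=> [[m1 m2 m3]|mu].
  have -> : u = (fun t => ((u t).1.1, (u t).1.2, (u t).2)).
    by apply/funext => t; case: (u t) => [[]].
  by apply: measurable_fun_pair => //; exact: measurable_fun_pair.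
by split; repeat apply: measurableT_comp => //.
Qed.

Lemma measurable_vec3D u v : measurable_fun setT u -> measurable_fun setT v ->
  measurable_fun setT (fun t => u t + v t : vec3 R).
Proof.
move=> /measurable_vec3P[u1 u2 u3] /measurable_vec3P[v1 v2 v3].
by apply/measurable_vec3P; split; exact: measurable_funD.
Qed.

Lemma measurable_vec3Z (a : T -> R) u : measurable_fun setT a -> measurable_fun setT u ->
  measurable_fun setT (fun t => a t *: u t : vec3 R).
Proof.
move=> ma /measurable_vec3P[u1 u2 u3].
by apply/measurable_vec3P; split; exact: measurable_funM.
Qed.

Lemma measurable_vec3N u : measurable_fun setT u ->
  measurable_fun setT (fun t => - u t : vec3 R).
Proof.
move=> mu; rewrite (_ : (fun t => _) = (fun t => (cst (-1) t) *: u t)).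
  exact: measurable_vec3Z.
by apply/funext => t; rewrite scaleN1r.
Qed.

Lemma measurable_dot3 u v : measurable_fun setT u -> measurable_fun setT v ->
  measurable_fun setT (fun t => dot3 (u t) (v t)).
Proof.
move=> /measurable_vec3P[u1 u2 u3] /measurable_vec3P[v1 v2 v3].
by apply: measurable_funD; [apply: measurable_funD|]; exact: measurable_funM.
Qed.

End measurable_vec3.

Section measurable_norm3.
Context {R : realType}.

Lemma measurable_norm3 : measurable_fun setT (@norm3 R).
Proof.
have ms : measurable_fun [set: R] (@Num.sqrt R).
  by apply: continuous_measurable_fun; exact: sqrt_continuous.
have md : measurable_fun [set: vec3 R] (fun g : vec3 R => dot3 g g).
  exact: measurable_dot3.
exact: (measurableT_comp ms md).
Qed.

Lemma measurable_sphere : measurable (@sphere R).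
Proof.
rewrite (_ : @sphere R = setT `&` @norm3 R @^-1` [set 1]); last by rewrite setTI.
exact: measurable_norm3.
Qed.

Lemma measurable_collision_shift d (T : measurableType d) (u v : T -> vec3 R) :
  measurable_fun setT u -> measurable_fun setT v ->
  measurable_fun setT (fun t => 2^-1 *: (u t - norm3 (u t) *: v t) : vec3 R).
Proof.
move=> mu mv; apply: measurable_vec3Z => //; apply: measurable_vec3D => //.
apply: measurable_vec3N; apply: measurable_vec3Z => //.
exact: (measurableT_comp measurable_norm3 mu).
Qed.

End measurable_norm3.

(* The plane measure gets its own constant because canonical inference for [\x] selects the
   instance for products of subprobabilities. *)
Definition lebesgue2 (R : realType) :
    set (measurableTypeR R * measurableTypeR R) -> \bar R :=
  (@lebesgue_measure R \x @lebesgue_measure R)%E.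

HB.instance Definition _ (R : realType) := Measure.on (@lebesgue2 R).

Lemma sigma_finite_lebesgue2 (R : realType) : sigma_finite setT (@lebesgue2 R).
Proof.
pose J (n : nat) : set R := `]- n%:R, n%:R[%classic.
exists (fun n => J n `*` J n).
  apply/seteqP; split => // -[x y] _; exists (Num.trunc (Num.max `|x| `|y|)).+1 => //=.
  have := truncnS_gt (Num.max `|x| `|y|); rewrite gt_max => /andP[xn yn].
  by split; rewrite /J/= in_itv/= -ltr_norml.
move=> n; split; first by apply: measurableX; exact: measurable_itv.
rewrite /lebesgue2 product_measure1E; [|exact: measurable_itv..].
have Joo : (@lebesgue_measure R (J n) < +oo)%E.
  by rewrite /J lebesgue_measure_itv/=; case: ifP => _; rewrite -?EFinB ltry.
by apply: lte_mul_pinfty => //; rewrite ge0_fin_numE.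
Qed.

HB.instance Definition _ (R : realType) :=
  Measure_isSigmaFinite.Build _ _ _ (@lebesgue2 R) (@sigma_finite_lebesgue2 R).

(** * Rotation of the velocity to the third axis and integration over shells *)

Section spherical.
Context {R : realType}.
Local Notation mu := (@lebesgue_measure R).
Local Notation mu2 := (@lebesgue2 R).
Local Notation rT := (measurableTypeR R).
Local Open Scope ereal_scope.

Lemma ge0_integral_lebesgue3_z (G : vec3 R -> \bar R) :
  measurable_fun setT G -> (forall g, 0 <= G g) ->
  \int[lebesgue3 R]_g G g = \int[mu]_z \int[(mu \x mu)%E]_p G (p, z).
Proof.
move=> mG G0.
exact: (@fubini_tonelli2 _ _ _ _ R mu2 mu G mG G0).
Qed.

(** The product is associated to the left, so splitting off the first coordinate takes Tonelli
    twice, followed by a regrouping of the last two coordinates. *)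
Lemma ge0_integral_lebesgue3_x (G : vec3 R -> \bar R) :
  measurable_fun setT G -> (forall g, 0 <= G g) ->
  \int[lebesgue3 R]_g G g = \int[mu]_x \int[(mu \x mu)%E]_p G (x, p.1, p.2).
Proof.
move=> mG G0.
apply: (eq_trans (@fubini_tonelli1 _ _ _ _ R mu2 mu G mG G0)).
apply: (eq_trans (@fubini_tonelli1 _ _ _ _ R mu mu _ _ _)).
- exact: (measurable_fun_fubini_tonelli_F G).
- by move=> p; exact: integral_ge0.
apply: eq_integral => x _.
have mx : measurable_fun setT (fun p : rT * rT => ((x, p.1, p.2) : vec3 R)).
  by apply: measurable_fun_pair => //; apply: measurable_fun_pair.
by rewrite [RHS]fubini_tonelli1//; exact: (measurableT_comp mG mx).
Qed.

Lemma norm3E (x y z : R) :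
  norm3 ((x, y, z) : vec3 R) = shell_norm z ((x, y) : rT * rT).
Proof. by rewrite /norm3 /dot3 /shell_norm/= !expr2. Qed.

(** This rotation takes [(a, b)] to the nonnegative half of the second axis: [(c, s)] is [(b, - a)]
    normalized, and the identity is taken when [(a, b)] vanishes. *)
Lemma unit_rotation (a b : R) : exists c s : R,
  [/\ c ^+ 2 + s ^+ 2 = 1, c * a + s * b = 0 & c * b - s * a = Num.sqrt (a ^+ 2 + b ^+ 2)]%R.
Proof.
have [ab0|ab0] := eqVneq (a ^+ 2 + b ^+ 2)%R 0%R.
  exists 1%R, 0%R; move: (ab0) => /eqP; rewrite paddr_eq0 ?sqr_ge0// !sqrf_eq0.
  move=> /andP[/eqP -> /eqP ->].
  by rewrite expr0n expr1n/= !mulr0 !addr0 subr0 sqrtr0.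
have p0 : (0 < a ^+ 2 + b ^+ 2)%R by rewrite lt_neqAle eq_sym ab0 addr_ge0 ?sqr_ge0.
have : (0 < Num.sqrt (a ^+ 2 + b ^+ 2))%R by rewrite sqrtr_gt0.
have : (Num.sqrt (a ^+ 2 + b ^+ 2) ^+ 2 = a ^+ 2 + b ^+ 2)%R by rewrite sqr_sqrtr// ltW.
move: (Num.sqrt _) => t tE t0; have tn0 : (t != 0)%R by rewrite gt_eqF.
exists (b / t)%R, (- a / t)%R; split.
- transitivity ((a ^+ 2 + b ^+ 2) / t ^+ 2)%R; first by field.
  by rewrite -tE divff// sqrf_eq0.
- by field.
- transitivity ((a ^+ 2 + b ^+ 2) / t)%R; first by field.
  by rewrite -tE expr2 mulfK.
Qed.

Variables (phi psi : R -> \bar R).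
Hypotheses (mphi : measurable_fun setT phi) (phi0 : forall r, 0 <= phi r).
Hypotheses (mpsi : measurable_fun setT psi) (psi0 : forall r, 0 <= psi r).

Let F (v g : vec3 R) := phi (norm3 g) * psi (dot3 v g).

Let mF v : measurable_fun setT (F v).
Proof.
apply: emeasurable_funM; first exact: (measurableT_comp mphi measurable_norm3).
have md : measurable_fun [set: vec3 R] (fun g : vec3 R => dot3 v g).
  exact: measurable_dot3.
exact: (measurableT_comp mpsi md).
Qed.

Let F0 v g : 0 <= F v g.
Proof. exact: mule_ge0. Qed.

Let I v := \int[lebesgue3 R]_g F v g.

(** Rotating the first two coordinates of [g] preserves [norm3 g], and in the dot product the
    rotation passes to [v] as its inverse. *)
Let rotate12 (c s v1 v2 v3 : R) : (c ^+ 2 + s ^+ 2 = 1)%R ->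
  I (v1, v2, v3) = I ((c * v1 + s * v2)%R, (c * v2 - s * v1)%R, v3).
Proof.
move=> cs.
have cs' (x y : R) : ((c * x - s * y) * (c * x - s * y) + 
    (s * x + c * y) * (s * x + c * y) = x * x + y * y)%R.
  transitivity ((c ^+ 2 + s ^+ 2) * (x * x + y * y))%R; first by ring.
  by rewrite cs mul1r.
have dd (x y z : R) : (v1 * (c * x - s * y) + v2 * (s * x + c * y) + v3 * z =
   (c * v1 + s * v2) * x + (c * v2 - s * v1) * y + v3 * z)%R by ring.
rewrite /I !(ge0_integral_lebesgue3_z _ (mF _) (F0 _)); apply: eq_integral => z _.
have mz : measurable_fun setT (fun p : rT * rT => ((p, z) : vec3 R)).
  exact: measurable_fun_pair.
rewrite -(ge0_integral_rotation _ _ _ (measurableT_comp (mF (v1, v2, v3)) mz)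
  (fun p => F0 _ _) cs).
apply: eq_integral => -[x y] _ /=; rewrite /F.
by rewrite /norm3 /dot3/= cs' dd.
Qed.

Let rotate23 (c s v1 v2 v3 : R) : (c ^+ 2 + s ^+ 2 = 1)%R ->
  I (v1, v2, v3) = I (v1, (c * v2 + s * v3)%R, (c * v3 - s * v2)%R).
Proof.
move=> cs.
have cs' (x y z : R) : (x * x + (c * y - s * z) * (c * y - s * z) +
    (s * y + c * z) * (s * y + c * z) = x * x + y * y + z * z)%R.
  transitivity (x * x + (c ^+ 2 + s ^+ 2) * (y * y + z * z))%R; first by ring.
  by rewrite cs mul1r addrA.
have dd (x y z : R) : (v1 * x + v2 * (c * y - s * z) + v3 * (s * y + c * z) =
   v1 * x + (c * v2 + s * v3) * y + (c * v3 - s * v2) * z)%R by ring.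
rewrite /I !(ge0_integral_lebesgue3_x _ (mF _) (F0 _)); apply: eq_integral => x _.
have mx : measurable_fun setT (fun p : rT * rT => ((x, p.1, p.2) : vec3 R)).
  by apply: measurable_fun_pair => //; apply: measurable_fun_pair.
rewrite -(ge0_integral_rotation _ _ _ (measurableT_comp (mF (v1, v2, v3)) mx)
  (fun p => F0 _ _) cs).
apply: eq_integral => -[y z] _ /=; rewrite /F.
by rewrite /norm3 /dot3/= cs' dd.
Qed.

(** A first rotation annihilates the first coordinate of [v], a second one the second coordinate;
    what is left on the third axis is the norm. *)
Let I_axis v : I v = I (0%R, 0%R, norm3 v).
Proof.
case: v => [[v1 v2] v3].
have [c [s [cs c0 cE]]] := unit_rotation v1 v2.
rewrite (rotate12 _ _ _ _ _ cs) c0 cE.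
have [c' [s' [cs' c0' cE']]] := unit_rotation (Num.sqrt (v1 ^+ 2 + v2 ^+ 2)) v3.
rewrite (rotate23 _ _ _ _ _ cs') c0' cE' norm3E /shell_norm/= sqr_sqrtr//.
by rewrite addr_ge0 ?sqr_ge0.
Qed.

Lemma ge0_integral_spherical (v : vec3 R) :
  \int[lebesgue3 R]_g (phi (norm3 g) * psi (dot3 v g)) =
  \int[mu]_(r in `[0%R, +oo[) ((2 * pi * r)%:E * phi r *
     \int[mu]_(z in `[(- r)%R, r]) psi (norm3 v * z)%R).
Proof.
transitivity (I v) => //; rewrite I_axis; set w := norm3 v.
have mpw : measurable_fun [set: rT] (fun z => psi (w * z)%R).
  by apply: measurableT_comp => //; exact: measurable_funM.
have mr : measurable_fun [set: rT] (fun r => (2 * pi * r)%:E).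
  by apply/measurable_EFinP; exact: measurable_funM.
have mrp : measurable_fun [set: rT] (fun r => (2 * pi * r)%:E * phi r).
  exact: emeasurable_funM.
rewrite /I (ge0_integral_lebesgue3_z _ (mF _) (F0 _)).
(* Pairs of a height [z] and a radius [r]. Extending the integrand by zero outside [D] turns both
   iterated integrals into integrals over the whole plane, where Tonelli exchanges them. *)
pose D : set (rT * rT) := [set q | `|q.1| <= q.2]%R.
have mD : measurable D.
  apply: measurable_set_bool; apply: measurable_fun_ler => //.
  by apply: measurableT_comp.
pose G : rT * rT -> \bar R :=
  (fun q => psi (w * q.1)%R * ((2 * pi * q.2)%:E * phi q.2)) \_ D.
have mG : measurable_fun setT G.
  apply/(measurable_restrictT _ mD); apply: measurable_funTS; apply: emeasurable_funM.
    exact: (measurableT_comp mpw).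
  exact: (measurableT_comp mrp).
have G0 q : 0 <= G q.
  rewrite /G patchE; case: ifPn => //; rewrite inE /D/= => qD.
  rewrite !mule_ge0// lee_fin mulr_ge0// ?mulr_ge0 ?pi_ge0//.
  by rewrite (le_trans _ qD).
transitivity (\int[mu]_z \int[mu]_r G (z, r)).
  apply: eq_integral => z _; rewrite /F.
  transitivity (\int[(mu \x mu)%E]_p (psi (w * z)%R * phi (shell_norm z p))).
    apply: eq_integral => -[x y] _; rewrite norm3E muleC; congr (psi _ * _).
    by rewrite /dot3/= !mul0r !add0r.
  rewrite ge0_integralZl//; last exact: (measurableT_comp mphi (measurable_shell_norm z)).
  rewrite (ge0_integral_shell z phi mphi phi0) -ge0_integralZl//; last 2 first.
  - exact: measurable_funTS.
  - move=> r; rewrite /= in_itv/= andbT => zr.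
    rewrite mule_ge0// lee_fin mulr_ge0 ?mulr_ge0 ?pi_ge0//.
    by rewrite (le_trans _ zr).
  rewrite integral_mkcond; apply: eq_integral => r _; rewrite /G !patchE.
  rewrite (_ : ((z, r) \in D) = (r \in `[`|z|%R, +oo[%classic))//.
  by apply/idP/idP => /set_mem zr; apply/mem_set; move: zr; rewrite /D/= in_itv/= andbT.
rewrite fubini_tonelli// [RHS]integral_mkcond; apply: eq_integral => r _.
(* No height satisfies [|z| <= r] when [r] is negative. *)
rewrite patchE; case: ifPn => [|/negP] r0; last first.
  apply: integral0_eq => z _; rewrite /G patchE; case: ifPn => //; rewrite inE /D/= => zr.
  by exfalso; apply: r0; rewrite inE/= in_itv/= andbT (le_trans _ zr).
rewrite -ge0_integralZl//; last 2 first.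
- exact: measurable_funTS.
- move: r0; rewrite inE/= in_itv/= andbT => r0.
  by rewrite mule_ge0// lee_fin mulr_ge0 ?mulr_ge0 ?pi_ge0.
rewrite [RHS]integral_mkcond; apply: eq_integral => z _; rewrite /G !patchE.
rewrite (_ : ((z, r) \in D) = (z \in `[(- r)%R, r]%classic)); first by rewrite muleC.
by apply/idP/idP => /set_mem zr; apply/mem_set; move: zr; rewrite /D/= in_itv/= ler_norml.
Qed.

End spherical.

(** * Gaussian tails *)

Section radial_density.
Context {R : realType}.
Local Notation mu := (@lebesgue_measure R).
Local Notation rT := (measurableTypeR R).
Variables (k lambda w : R).
Hypotheses (k0 : 0 < k) (lambda0 : 0 <= lambda) (lambda1 : lambda <= 1) (w0 : 0 <= w).

(** The integrand of [relative_truncation_error], with [w] in the role of the speed [v]. *)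
Definition radial_density (r : R) : R :=
  expR (- (k * (w - r) ^+ 2))
  * (if w == 0 then 1 else (1 - expR (- (4 * k * w * r))) / (4 * k * w * r))
  * r `^ (lambda + 2).

(** At base 0 the law of exponents requires a nonzero sum of exponents, which holds for positive [n]
    since [lambda] is nonnegative. *)
Lemma powR_split (r : R) n : 0 <= r -> r `^ (lambda + n%:R) = r `^ lambda * r ^+ n.
Proof.
move=> r0; case: n => [|n]; first by rewrite addr0 expr0 mulr1.
have ln0 : lambda + n.+1%:R != 0 by rewrite gt_eqF// ltr_wpDl.
by rewrite powRD ?powR_mulrn// (negbTE ln0).
Qed.

(* The right-hand side has no division by [r], hence is clearly measurable; at [r = 0] both
   sides vanish. *)
Lemma radial_densityE (r : R) : 0 <= r -> radial_density r =
  expR (- (k * (w - r) ^+ 2)) * (if w == 0 then r `^ (lambda + 2)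
    else (1 - expR (- (4 * k * w * r))) / (4 * k * w) * r `^ (lambda + 1)).
Proof.
move=> r0; rewrite /radial_density -mulrA; congr (_ * _).
case: ifPn => wn0; first by rewrite mul1r.
rewrite -[lambda + 1]/(lambda + 1%:R) -[lambda + 2]/(lambda + 2%:R) !powR_split//.
move: r0; rewrite le_eqVlt => /predU1P[<-|r0].
  by rewrite !expr0n/= !mulr0.
by field; rewrite wn0 !gt_eqF.
Qed.

Lemma measurable_radial_density : measurable_fun (`[0, +oo[%classic : set R) radial_density.
Proof.
pose e (r : R) : R := expR (- (k * (w - r) ^+ 2)) *
    (if w == 0 then r `^ (lambda + 2)
     else (1 - expR (- (4 * k * w * r))) / (4 * k * w) * r `^ (lambda + 1)).
have me : measurable_fun setT e; last first.
  apply: (@eq_measurable_fun _ _ _ _ _ e); last exact: measurable_funTS.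
  by move=> r; rewrite inE/= in_itv/= andbT => /radial_densityE.
apply: measurable_funM.
  apply: measurableT_comp => //; apply: measurableT_comp => //.
  by apply: measurable_funM => //; apply: measurable_funX; exact: measurable_funB.
case: (w == 0); first exact: measurable_powR.
apply: measurable_funM; last exact: measurable_powR.
apply: measurable_funM => //; apply: measurable_funB => //.
by apply: measurableT_comp => //; apply: measurableT_comp => //; exact: measurable_funM.
Qed.

Lemma radial_density_ge0 (r : R) : 0 <= r -> 0 <= radial_density r.
Proof.
move=> r0; rewrite !mulr_ge0 ?expR_ge0 ?powR_ge0//.
case: ifPn => // _; have x0 : 0 <= 4 * k * w * r by rewrite !mulr_ge0// ltW.
by rewrite divr_ge0// subr_ge0 expR_le1 oppr_le0.
Qed.

(** The quotient is at most 1 and the power at most [7 * expR r]; the Gaussian absorbs this growth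
    and still leaves [expR (- r)], an integrable majorant. *)
Lemma radial_density_le (r : R) : 0 <= r ->
  radial_density r <= 7 * expR (2 * w + k^-1) * expR (- r).
Proof.
move=> r0.
(* This is [1 - exp (- x) <= x]. At [r = 0] with [w != 0] the quotient is 0, by the convention on
   division by zero. *)
have br1 : (if w == 0 then 1 else (1 - expR (- (4 * k * w * r))) / (4 * k * w * r)) <= 1.
  case: ifPn => // wn0; move: r0; rewrite le_eqVlt => /predU1P[<-|r0].
    by rewrite !mulr0 invr0 mulr0.
  have x0 : 0 < 4 * k * w * r by rewrite !mulr_gt0// lt_neqAle eq_sym wn0.
  rewrite ler_pdivrMr// mul1r.
  by have := expR_ge1Dx (- (4 * k * w * r)); lra.
(* Below 1 the power is at most 1. Above 1 it is at most [r ^+ 3], and the cubic term of the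
   exponential series gives [r ^+ 3 <= 6 * expR r]; 7 is a convenient larger constant. *)
have pr : r `^ (lambda + 2) <= 7 * expR r.
  have [r1|r1] := leP r 1.
    rewrite (@le_trans _ _ 1)//.
      have p1 : 1 `^ (lambda + 2) = 1 :> R by rewrite powR1.
      rewrite -[leRHS]p1; by apply: ge0_ler_powR; rewrite ?nnegrE// addr_ge0.
    by have := expR_ge1Dx r; lra.
  rewrite (@le_trans _ _ (r `^ 3%:R))//.
    by apply: ler_powR; [exact: ltW|rewrite -lerBrDr; apply: (le_trans lambda1); lra].
  rewrite powR_mulrn// ?(le_trans ler01 (ltW r1))//.
  have := expR_ge1Dxn 2 r0; rewrite (_ : 3`!%:R = 6 :> R)//.
  have := expR_gt0 r; move: (expR r) (r ^+ 3) => e t; lra.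
(* Completing the square: [(k (r - w) - 1)^2 >= 0]. *)
have ex : expR (- (k * (w - r) ^+ 2)) * expR r <= expR (2 * w + k^-1) * expR (- r).
  rewrite -!expRD ler_expR -subr_ge0.
  have -> : 2 * w + k^-1 - r - (- (k * (w - r) ^+ 2) + r) = (k * (r - w) - 1) ^+ 2 / k.
    by field; rewrite gt_eqF.
  by rewrite divr_ge0 ?sqr_ge0// ltW.
rewrite /radial_density (@le_trans _ _ (expR (- (k * (w - r) ^+ 2)) * 1 * (7 * expR r)))//.
  apply: ler_pM => //.
  - rewrite mulr_ge0 ?expR_ge0//.
    case: ifPn => // _; have x0 : 0 <= 4 * k * w * r by rewrite !mulr_ge0// ltW.
    by rewrite divr_ge0// subr_ge0 expR_le1 oppr_le0.
  - exact: powR_ge0.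
  - by rewrite ler_wpM2l// expR_ge0.
rewrite mulr1 mulrCA -mulrA.
by rewrite ler_pM2l.
Qed.

(** By [radial_density_le] the density is dominated by [C] times the exponential probability density
    of rate 1, whose total mass is 1. *)
Lemma integral_radial_density_lty :
  (\int[mu]_(r in `[0%R, +oo[) (radial_density r)%:E < +oo)%E.
Proof.
pose C := 7 * expR (2 * w + k^-1).
have C0 : 0 <= C by rewrite mulr_ge0// expR_ge0.
have mpdf : measurable_fun [set: R] (fun r => (exponential_pdf 1 r)%:E).
  by apply/measurable_EFinP; exact: measurable_exponential_pdf.
apply: (@le_lt_trans _ _ (\int[mu]_(r in `[0%R, +oo[) (C%:E * (exponential_pdf 1 r)%:E))%E).
  apply: ge0_le_integral => //=.
  - by move=> r; rewrite /= in_itv/= andbT => /radial_density_ge0.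
  - by apply/measurable_EFinP; exact: measurable_radial_density.
  - by apply: measurable_funTS; exact: measurable_funeM.
  - move=> r; rewrite /= in_itv/= andbT => r0.
    by rewrite exponential_pdfE// -EFinM lee_fin mul1r mulN1r radial_density_le.
rewrite ge0_integralZl//=; last 2 first.
- exact: measurable_funTS.
- by move=> r _; rewrite lee_fin exponential_pdf_ge0.
apply: (@le_lt_trans _ _ (C%:E * 1)%E); last by rewrite mule1 ltry.
apply: lee_wpmul2l; first by rewrite lee_fin.
rewrite -(integral_exponential_pdf ltr01); apply: ge0_subset_integral => //=.
by move=> r _; rewrite lee_fin exponential_pdf_ge0.
Qed.

Lemma integral_expR_segment (a r : R) : a != 0 -> 0 < r ->
  (\int[mu]_(z in `[(- r)%R, r]) (expR (- (a * z)))%:E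
  = ((expR (a * r) - expR (- (a * r))) / a)%:E)%E.
Proof.
move=> a0 r0.
pose F (z : R) : R := - a^-1 * expR (- a * z).
have cf : continuous (fun z : R => expR (- (a * z)) : R).
  move=> z; apply: continuous_comp; last exact: continuous_expR.
  by apply: cvgN; apply: cvgM; [exact: cvg_cst|exact: cvg_id].
have cF : continuous F.
  move=> z; apply: cvgM; first exact: cvg_cst.
  apply: continuous_comp; last exact: continuous_expR.
  by apply: cvgM; [exact: cvg_cst|exact: cvg_id].
have dF (z : R) : is_derive z 1 F (expR (- (a * z))).
  have dl : is_derive z 1 (cst (- a) * @id R) (cst (- a) z *: 1 + id z *: 0).
    exact: is_deriveM.
  have de := @is_derive1_comp _ expR (cst (- a) * @id R) z _ _ (is_derive_expR _) dl.
  apply: (is_derive_eq (is_deriveM (is_derive_cst (- a^-1) z 1) de)).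
  by rewrite /GRing.scale/= !fctE /cst/= !mulNr; field.
rewrite (@continuous_FTC2 _ (fun z => expR (- (a * z))) F).
- rewrite /F -EFinB mulrNN (mulNr a r); congr EFin.
  by move: (expR _) (expR _) => x y; field.
- by lra.
- exact: continuous_subspaceT.
- split; first by move=> z _; case: (dF z).
    by apply: cvg_at_right_filter; exact: cF.
  by apply: cvg_at_left_filter; exact: cF.
- by move=> z _; rewrite derive1E; case: (dF z).
Qed.

(** The origin of the bracketed factor: the inner integral is the difference of the exponentials of
    [2 * k * w * r] and its opposite, divided by [2 * k * w]. Factoring out the larger one completes
    the square in the Gaussian and leaves [1 - expR (- (4 * k * w * r))]. For [w = 0] the segment
    has length [2 * r], which yields the limiting value 1. *)
Lemma radial_density_slice (r : R) : 0 <= r ->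
  (((2 * pi * r)%:E * (expR (- (k * (w ^+ 2 + r ^+ 2))) * r `^ lambda)%:E
    * \int[mu]_(z in `[(- r)%R, r]) (expR (- (2 * k * (w * z))))%:E)
  = (4 * pi)%:E * (radial_density r)%:E)%E.
Proof.
rewrite le_eqVlt => /predU1P[<-|r0].
  have p0 (t : R) : 0 < t -> 0 `^ (lambda + t) = 0.
    by move=> t0; rewrite powR0// gt_eqF// ltr_wpDl.
  rewrite mulr0 !mul0e radial_densityE// !p0//.
  by case: (w == 0); rewrite !mulr0 mule0.
rewrite radial_densityE ?(ltW r0)//.
rewrite -[lambda + 1]/(lambda + 1%:R) -[lambda + 2]/(lambda + 2%:R).
rewrite !powR_split ?(ltW r0)//.
have [->|wn0] := eqVneq w 0.
  under eq_integral do rewrite mul0r mulr0 oppr0 expR0.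
  have mur : mu `[(- r)%R, r]%classic = (2 * r)%:E.
    rewrite lebesgue_measure_itv/= lte_fin; have -> : (- r < r) = true by lra.
    by rewrite -EFinB; congr EFin; ring.
  rewrite [X in (_ * X)%E = _](_ : _ = (2 * r)%:E); last first.
    by rewrite integral_cst// mul1e; exact: mur.
  rewrite -!EFinM expr0n/= add0r sub0r sqrrN; congr EFin.
  by move: (expR _) (r `^ lambda) => x y; ring.
under eq_integral do rewrite mulrA.
rewrite integral_expR_segment//; last by rewrite mulf_neq0// gt_eqF// mulr_gt0.
rewrite -!EFinM; congr EFin.
have -> : expR (- (k * (w - r) ^+ 2)) =
    expR (- (k * (w ^+ 2 + r ^+ 2))) * expR (2 * k * w * r).
  by rewrite -expRD; congr expR; ring.
have -> : expR (- (4 * k * w * r)) = expR (- (2 * k * w * r)) * expR (- (2 * k * w * r)).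
  by rewrite -expRD; congr expR; ring.
have : expR (- (2 * k * w * r)) * expR (2 * k * w * r) = 1.
  by rewrite -expRD addNr expR0.
move: (expR (- (2 * k * w * r))) (expR (2 * k * w * r)) => x y xy.
have xyx : y * (1 - x * x) = y - x.
  by rewrite mulrBr mulr1 mulrCA (mulrC y) xy mulr1.
move: (expR _) (r `^ lambda) => e p.
transitivity (4 * pi * (e * (y - x) * p * r / (4 * k * w))).
  by field; rewrite wn0 !gt_eqF.
by rewrite -xyx; field; rewrite wn0 !gt_eqF.
Qed.

End radial_density.

(** * Norm identities and conservation of energy *)

Section vec3_theory.
Context {R : realType}.
Implicit Types v g T : vec3 R.

Lemma dot3_ge0 v : 0 <= dot3 v v.
Proof. by rewrite /dot3 !addr_ge0// -expr2 sqr_ge0. Qed.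

Lemma norm3_ge0 v : 0 <= norm3 v.
Proof. exact: sqrtr_ge0. Qed.

Lemma sqr_norm3 v : norm3 v ^+ 2 = dot3 v v.
Proof. by rewrite /norm3 sqr_sqrtr// dot3_ge0. Qed.

Lemma sqr_norm3D v g :
  norm3 (v + g) ^+ 2 = norm3 v ^+ 2 + 2 * dot3 v g + norm3 g ^+ 2.
Proof.
rewrite !sqr_norm3 /dot3; case: v => [[v1 v2] v3]; case: g => [[g1 g2] g3] /=.
have E (a b c d e f : R) : (a + d) * (a + d) + (b + e) * (b + e) + (c + f) * (c + f) =
  a * a + b * b + c * c + 2 * (a * d + b * e + c * f) + (d * d + e * e + f * f) by ring.
exact: E.
Qed.

(** The two sides differ by half of [|g|^2 |T|^2 - |g|^2], which vanishes on the unit sphere. *)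
Lemma collision_energy v g T : norm3 T = 1 ->
  norm3 (post_v v g T) ^+ 2 + norm3 (post_w v g T) ^+ 2 =
  norm3 v ^+ 2 + norm3 (v + g) ^+ 2.
Proof.
move=> T1; have dT : dot3 T T = 1 by rewrite -sqr_norm3 T1 expr1n.
have nn : norm3 g * norm3 g = dot3 g g by rewrite -expr2 sqr_norm3.
move: dT nn; rewrite /post_v /post_w; move: (norm3 g) => n.
rewrite !sqr_norm3 /dot3.
case: v => [[v1 v2] v3]; case: g => [[g1 g2] g3]; case: T {T1} => [[t1 t2] t3] /=.
have E (a b c d e f x y z : R) : x * x + y * y + z * z = 1 ->
  n * n = d * d + e * e + f * f ->
  let a' := a + 2^-1 * (d - n * x) in let b' := b + 2^-1 * (e - n * y) in
  let c' := c + 2^-1 * (f - n * z) in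
  let p' := a + d - 2^-1 * (d - n * x) in let q' := b + e - 2^-1 * (e - n * y) in
  let r' := c + f - 2^-1 * (f - n * z) in
  a' * a' + b' * b' + c' * c' + (p' * p' + q' * q' + r' * r') =
  a * a + b * b + c * c + ((a + d) * (a + d) + (b + e) * (b + e) + (c + f) * (c + f)).
  move=> xyz nn /=.
  transitivity (a * a + b * b + c * c +
    ((a + d) * (a + d) + (b + e) * (b + e) + (c + f) * (c + f))
    + 2^-1 * (n * n * (x * x + y * y + z * z) - (d * d + e * e + f * f))).
    by field.
  by rewrite xyz nn mulr1 subrr mulr0 addr0.
exact: E.
Qed.

End vec3_theory.

(** * The Gaussian integral outside a ball *)

Section gaussian_tail.
Context {R : realType}.
Local Notation mu := (@lebesgue_measure R).
Local Notation rT := (measurableTypeR R).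
Variables (k lambda : R) (k0 : 0 < k) (lambda0 : 0 <= lambda).
Local Open Scope ereal_scope.

(** Expanding [|v + g|^2] splits the integrand into a function of [norm3 g] and one of [dot3 v g],
    so that [ge0_integral_spherical] applies and [radial_density_slice] evaluates the inner
    integral. *)
Lemma integral_gaussian_tail (v : vec3 R) (a : R) :
  \int[lebesgue3 R]_(g in [set g | (a < norm3 g)%R])
    (expR (- (k * norm3 (v + g) ^+ 2)) * norm3 g `^ lambda)%:E =
  (4 * pi)%:E * \int[mu]_(r in `[0%R, +oo[ `&` `]a, +oo[)
    (radial_density k lambda (norm3 v) r)%:E.
Proof.
(* The cutoff [a < r] depends on the norm alone, so it is put into the radial factor. *)
pose phi (r : R) : \bar R := if (a < r)%R then
  (expR (- (k * (norm3 v ^+ 2 + r ^+ 2))) * r `^ lambda)%:E else 0.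
pose psi (t : R) : \bar R := (expR (- (2 * k * t)))%:E.
have mphi : measurable_fun setT phi.
  apply: measurable_fun_ifT => //; first exact: measurable_fun_ltr.
  apply/measurable_EFinP; apply: measurable_funM; last exact: measurable_powR.
  apply: measurableT_comp => //; apply: measurableT_comp => //.
  by apply: measurable_funM => //; apply: measurable_funD => //; exact: measurable_funX.
have phi0 r : 0 <= phi r.
  by rewrite /phi; case: ifPn => // _; rewrite lee_fin mulr_ge0 ?expR_ge0 ?powR_ge0.
have mpsi : measurable_fun setT psi.
  have ml : measurable_fun [set: R] (fun t : R => - (2 * k * t))%R.
    by apply: measurableT_comp => //; exact: measurable_funM.
  by apply/measurable_EFinP; exact: (measurableT_comp (@measurable_expR R) ml).
have psi0 r : 0 <= psi r by rewrite lee_fin expR_ge0.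
transitivity (\int[lebesgue3 R]_g (phi (norm3 g) * psi (dot3 v g))).
  rewrite integral_mkcond; apply: eq_integral => g _; rewrite patchE /phi.
  rewrite (_ : (g \in [set g | (a < norm3 g)%R]) = (a < norm3 g)%R); last first.
    by apply/idP/idP => [/set_mem//|ag]; exact/mem_set.
  case: ifPn => _; last by rewrite mul0e.
  rewrite -EFinM mulrAC -expRD sqr_norm3D; congr (expR _ * _)%:E.
  by ring.
rewrite (ge0_integral_spherical _ _ mphi phi0 mpsi psi0).
have mI : measurable (`[0%R, +oo[%classic : set R) by exact: measurable_itv.
have mJ : measurable (`[0%R, +oo[ `&` `]a, +oo[ : set R).
  by apply: measurableI; exact: measurable_itv.
have md : measurable_fun (`[0%R, +oo[%classic : set R)
    (fun r => (radial_density k lambda (norm3 v) r)%:E).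
  by apply/measurable_EFinP; apply: measurable_radial_density => //; exact: norm3_ge0.
rewrite -ge0_integralZl//; last 3 first.
- by apply: measurable_funS md => // r [].
- move=> r [/=]; rewrite in_itv/= andbT => r0 _.
  by rewrite lee_fin radial_density_ge0// norm3_ge0.
- by rewrite lee_fin mulr_ge0// pi_ge0.
rewrite integral_mkcondr; apply: eq_integral => r.
rewrite inE/= in_itv/= andbT patchE => r0.
rewrite (_ : (r \in `]a, +oo[%classic) = (a < r)%R); last first.
  apply/idP/idP => [/set_mem|ag]; first by rewrite /= in_itv/= andbT.
  by apply/mem_set; rewrite /= in_itv/= andbT.
rewrite /phi; case: ifPn => _; last by rewrite mule0 mul0e.
by rewrite -radial_density_slice ?norm3_ge0.
Qed.

End gaussian_tail.

(** * The collision density *)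

Section sphere_area.
Context {R : realType}.
Local Notation mu := (@lebesgue_measure R).
Local Notation rT := (measurableTypeR R).
Local Open Scope ereal_scope.

Lemma integral_sin_0pi : \int[mu]_(x in `[0%R, pi]) (sin x)%:E = 2%:E.
Proof.
have cN : continuous (fun x : R => - cos x)%R.
  by move=> x; apply: cvgN; exact: continuous_cos.
have dN (x : R) : is_derive x 1%R (fun x : R => - cos x)%R (sin x).
  by apply: is_derive_eq; rewrite opprK.
rewrite (@continuous_FTC2 _ sin (fun x => - cos x)%R).
- by rewrite cospi cos0 -EFinB; congr EFin; ring.
- exact: pi_gt0.
- by apply: continuous_subspaceT; exact: continuous_sin.
- split; first by move=> x _; case: (dN x).
    by apply: cvg_at_right_filter; exact: cN.
  by apply: cvg_at_left_filter; exact: cN.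
- by move=> x _; rewrite derive1E; case: (dN x).
Qed.

Lemma sphere_area : @sphere_measure R setT = (4 * pi)%:E.
Proof.
pose D : set (rT * rT) := `[0%R, pi] `*` `[0%R, (2 * pi)%R].
have mD : measurable D by apply: measurableX; exact: measurable_itv.
have ms : measurable_fun [set: rT * rT] (fun p : rT * rT => (sin p.1)%:E).
  apply/measurable_EFinP; apply: measurableT_comp => //.
  by apply: continuous_measurable_fun; exact: continuous_sin.
rewrite /sphere_measure preimage_setT setIT integral_mkcond -/D.
rewrite fubini_tonelli1; last 2 first.
- by apply/(measurable_restrictT _ mD); exact: measurable_funTS.
- move=> p; apply: erestrict_ge0 => {}p [/=]; rewrite in_itv/= => px _.
  by rewrite lee_fin sin_ge0_pi.
have -> : (4 * pi)%:E = (2 * pi)%:E * \int[mu]_(x in `[0%R, pi]) (sin x)%:E.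
  by rewrite integral_sin_0pi -EFinM; congr EFin; ring.
rewrite -ge0_integralZl//; last 3 first.
- apply/measurable_EFinP; apply: measurable_funTS.
  by apply: continuous_measurable_fun; exact: continuous_sin.
- by move=> x; rewrite /= in_itv/= lee_fin => /sin_ge0_pi.
- by rewrite lee_fin mulr_ge0// pi_ge0.
rewrite [RHS]integral_mkcond; apply: eq_integral => x _; rewrite /fubini_F patchE.
case: ifPn => [/set_mem|/negP] x0.
  transitivity (\int[mu]_(y in `[0%R, (2 * pi)%R]) (cst (sin x)%:E y)).
    rewrite [RHS]integral_mkcond; apply: eq_integral => y _; rewrite !patchE.
    rewrite (_ : ((x, y) \in D) = (y \in `[0%R, (2 * pi)%R]%classic))//.
    by apply/idP/idP => /set_mem; [case=> _ yD; exact/mem_set|move=> yD; exact/mem_set].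
  have mu2pi : mu `[0%R, (2 * pi)%R]%classic = (2 * pi)%:E.
    rewrite lebesgue_measure_itv/= lte_fin mulr_gt0 ?pi_gt0//.
    by rewrite sube0.
  rewrite integral_cst; last exact: measurable_itv.
  by rewrite muleC; congr (_ * _); exact: mu2pi.
apply: integral0_eq => y _; rewrite patchE; case: ifPn => // /set_mem [xD _].
by exfalso; apply: x0; exact/mem_set.
Qed.

End sphere_area.

(** Finiteness gives access to Tonelli for integrals over the sphere that depend on a parameter. *)
Lemma fin_num_sphere_measure (R : realType) : fin_num_fun (@sphere_measure R).
Proof.
have A4 : (@sphere_measure R setT < +oo)%E by rewrite sphere_area ltry.
exact: lty_fin_num_fun A4.
Qed.

HB.instance Definition _ (R : realType) :=
  Measure_isFinite.Build _ _ _ (@sphere_measure R) (@fin_num_sphere_measure R).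

Section collision_density.
Context {R : realType}.
Local Notation rT := (measurableTypeR R).
Local Notation sigma := (@sphere_measure R).

(** By Cauchy-Schwarz the argument of [acos] lies between -1 and 1; at [g = 0] it is 0. The kernel
    formula [B_def] is available only for angles in this range. *)
Lemma scattering_angle_itv (g Theta : vec3 R) : norm3 Theta = 1 ->
  0 <= scattering_angle g Theta <= pi.
Proof.
move=> T1; suff CS : -1 <= dot3 g Theta / norm3 g <= 1.
  by rewrite /scattering_angle acos_ge0// acos_lepi.
have [g0|g0] := eqVneq (norm3 g) 0; first by rewrite g0 invr0 mulr0; lra.
have gp : 0 < norm3 g by rewrite lt_neqAle eq_sym g0 norm3_ge0.
rewrite -ler_norml normrM normfV (gtr0_norm gp) ler_pdivrMr// mul1r.
rewrite -(ger0_norm (norm3_ge0 g)) -ler_sqr ?nnegrE// !real_normK ?num_real//.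
rewrite -[leRHS]mulr1 -(expr1n _ 2) -T1 !sqr_norm3 /dot3.
case: g {g0 gp} => [[g1 g2] g3]; case: Theta {T1} => [[t1 t2] t3] /=.
(* Lagrange's identity: the defect in Cauchy-Schwarz is a sum of three squares. *)
have E (a b c x y z : R) : (a * x + b * y + c * z) ^+ 2 <=
    (a * a + b * b + c * c) * (x * x + y * y + z * z).
  rewrite -subr_ge0.
  have -> : (a * a + b * b + c * c) * (x * x + y * y + z * z) - (a * x + b * y + c * z) ^+ 2
      = (a * y - b * x) ^+ 2 + (a * z - c * x) ^+ 2 + (b * z - c * y) ^+ 2 by ring.
  by rewrite !addr_ge0 ?sqr_ge0.
exact: E.
Qed.

Variables (f : vec3 R -> R) (B : R -> R -> R) (c k Bt lambda : R).
Hypotheses (mf : measurable_fun setT f) (f0 : forall v, 0 <= f v).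
Hypothesis f_le : forall v : vec3 R, f v <= c * expR (- (k * norm3 v ^+ 2)).
Hypothesis Bt0 : 0 < Bt.
Hypothesis B_def : forall g chi : R, 0 <= g -> 0 <= chi -> chi <= pi ->
  B g chi = g `^ lambda * Bt.

Let h (v g Theta : vec3 R) : R :=
  (f (post_v v g Theta) * f (post_w v g Theta) - f v * f (v + g)) *
  (norm3 g `^ lambda * Bt).

Let M (v g : vec3 R) : R := c ^+ 2 * Bt * expR (- (k * norm3 v ^+ 2)) *
  (expR (- (k * norm3 (v + g) ^+ 2)) * norm3 g `^ lambda).

(** [B_def] is applied under the integral, where [Theta] is a unit vector; the resulting integrand
    [h] is jointly measurable. *)
Let collision_densityE v g :
  collision_density B f v g = \int[sigma]_(Theta in @sphere R) h v g Theta.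
Proof.
apply: eq_Rintegral => Theta /set_mem T1; congr (_ * _).
have /andP[chi0 chipi] := scattering_angle_itv g _ T1.
by rewrite B_def// norm3_ge0.
Qed.

(** The gain and loss products lie between 0 and one common Gaussian bound, by [collision_energy]
    for the gain, so their difference obeys that bound without a factor 2. *)
Let h_le v g Theta : norm3 Theta = 1 -> `|h v g Theta| <= M v g.
Proof.
move=> T1; rewrite /h normrM (ger0_norm (_ : 0 <= norm3 g `^ lambda * Bt)); last first.
  by rewrite mulr_ge0 ?powR_ge0// ltW.
have prod_le (x y : vec3 R) : norm3 x ^+ 2 + norm3 y ^+ 2 = norm3 v ^+ 2 + norm3 (v + g) ^+ 2 ->
    0 <= f x * f y <= c ^+ 2 * expR (- (k * norm3 v ^+ 2)) * expR (- (k * norm3 (v + g) ^+ 2)).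
  move=> xy; rewrite mulr_ge0//=.
  apply: (le_trans (ler_pM (f0 x) (f0 y) (f_le x) (f_le y))).
  rewrite mulrACA -expr2 -mulrA -!expRD -!opprD -!mulrDr xy.
  exact: lexx.
have /andP[p0 p1] := prod_le _ _ (collision_energy v g Theta T1).
have /andP[q0 q1] := prod_le v (v + g) erefl.
have -> : M v g = c ^+ 2 * expR (- (k * norm3 v ^+ 2)) * expR (- (k * norm3 (v + g) ^+ 2))
    * (norm3 g `^ lambda * Bt).
  rewrite /M; move: (expR _) (expR _) (_ `^ _) => x y z; ring.
rewrite ler_wpM2r//; first by rewrite mulr_ge0 ?powR_ge0// ltW.
by rewrite ler_norml; apply/andP; split; lra.
Qed.

Let mh v : measurable_fun setT (fun p : vec3 R * vec3 R => h v p.1 p.2).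
Proof.
have ms : measurable_fun setT (fun p : vec3 R * vec3 R =>
    2^-1 *: (p.1 - norm3 p.1 *: p.2) : vec3 R).
  exact: measurable_collision_shift.
have mvg : measurable_fun setT (fun p : vec3 R * vec3 R => v + p.1 : vec3 R).
  exact: measurable_vec3D.
apply: measurable_funM.
  apply: measurable_funB; apply: measurable_funM => //.
  - by apply: measurableT_comp => //; exact: measurable_vec3D.
  - apply: measurableT_comp => //; apply: measurable_vec3D => //.
    exact: measurable_vec3N.
  - exact: measurableT_comp.
apply: measurable_funM => //.
have mn : measurable_fun setT (fun p : vec3 R * vec3 R => norm3 p.1).
  exact: (measurableT_comp (@measurable_norm3 R)).
have mp : measurable_fun [set: R] (fun x : R => x `^ lambda) by exact: measurable_powR.
exact: (measurableT_comp mp mn).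
Qed.

(** Tonelli gives measurability in [g] for nonnegative integrands. As [h] changes sign, its positive
    and negative parts are integrated separately and then subtracted. *)
Lemma measurable_collision_density v : measurable_fun setT (collision_density B f v).
Proof.
rewrite (_ : collision_density B f v =
    (fun g => \int[sigma]_(Theta in @sphere R) h v g Theta)); last first.
  by apply/funext => g; exact: collision_densityE.
pose S : set (vec3 R * vec3 R) := [set p | @sphere R p.2].
have mS : measurable S.
  by rewrite -[S]setTI; apply: measurable_snd => //; exact: measurable_sphere.
apply: measurableT_comp => //.
have main (q : vec3 R * vec3 R -> \bar R) : measurable_fun setT q -> (forall p, 0 <= q p)%E ->
    measurable_fun setT (fun g => \int[sigma]_(Theta in @sphere R) q (g, Theta))%E.
  move=> mq q0.
  rewrite (_ : (fun g => _) = fubini_F sigma (q \_ S)).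
    apply: measurable_fun_fubini_tonelli_F.
      by apply/(measurable_restrictT _ mS); exact: measurable_funTS.
    by move=> p; exact: erestrict_ge0.
  apply/funext => g; rewrite /fubini_F [LHS]integral_mkcond; apply: eq_integral => Theta _.
  rewrite !patchE (_ : ((g, Theta) \in S) = (Theta \in @sphere R))//.
pose H (p : vec3 R * vec3 R) : \bar R := (h v p.1 p.2)%:E.
have mH : measurable_fun setT H by apply/measurable_EFinP; exact: mh.
rewrite (_ : (fun g => _) = (fun g => \int[sigma]_(Theta in @sphere R) H^\+ (g, Theta) -
   \int[sigma]_(Theta in @sphere R) H^\- (g, Theta))%E); last first.
  apply/funext => g; rewrite [LHS]integralE.
  by congr (_ - _)%E; apply: eq_integral => T _; rewrite ?funeposE ?funenegE.
apply: emeasurable_funB; apply: main => //.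
- exact: measurable_funepos.
- exact: measurable_funeneg.
Qed.

(** The bound [M v g] does not depend on [Theta], and the sphere has area [4 * pi]. The same
    estimate makes [h] integrable, which allows the absolute value to move inside the integral. *)
Lemma collision_density_le v g :
  `|collision_density B f v g| <= 4 * pi * c ^+ 2 * Bt * expR (- (k * norm3 v ^+ 2)) *
    (expR (- (k * norm3 (v + g) ^+ 2)) * norm3 g `^ lambda).
Proof.
have mhg : measurable_fun (@sphere R) (fun Theta => h v g Theta).
  apply: measurable_funTS; have mg : measurable_fun setT (fun T : vec3 R => (g, T)).
    exact: measurable_fun_pair.
  exact: (measurableT_comp (mh v) mg).
have M0 : 0 <= M v g.
  apply: mulr_ge0; last by rewrite mulr_ge0 ?expR_ge0 ?powR_ge0.
  by rewrite mulr_ge0 ?expR_ge0// mulr_ge0 ?sqr_ge0// ltW.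
have le1 : (\int[sigma]_(T in @sphere R) `|(h v g T)%:E| <= (4 * pi * M v g)%:E)%E.
  apply: (@le_trans _ _ (\int[sigma]_(T in @sphere R) (cst (M v g)%:E T))%E).
    apply: ge0_le_integral => //.
    - exact: measurable_sphere.
    - by apply: measurableT_comp => //; exact/measurable_EFinP.
    - by move=> T T1; rewrite lee_fin h_le.
  rewrite integral_cst; last exact: measurable_sphere.
  have -> : (4 * pi * M v g)%:E = ((M v g)%:E * sigma setT)%E.
    by rewrite (sphere_area : sigma setT = _) -EFinM mulrC.
  apply: lee_wpmul2l; first exact: M0.
  by apply: le_measure; rewrite ?inE//; exact: measurable_sphere.
have int_h : sigma.-integrable (@sphere R) (EFin \o h v g).
  apply/integrableP; split; first exact/measurable_EFinP.
  exact: (le_lt_trans le1 (ltry _)).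
rewrite collision_densityE -lee_fin EFin_normr_Rintegral//; last exact: measurable_sphere.
apply: (le_trans (le_abse_integral _ measurable_sphere (measurable_int _ int_h))).
apply: (le_trans le1); rewrite lee_fin /M.
by move: (expR _) (expR _) (_ `^ _) => x y z; lra.
Qed.

End collision_density.

(** * The truncation error as the tail of the collision density *)

Theorem theorem1 (R : realType) (f : vec3 R -> R) (B : R -> R -> R)
    (c k Bt lambda gtr : R)
    (f_pdf : velocity_pdf f)
    (c_gt0 : 0 < c) (k_gt0 : 0 < k)
    (f_le : forall v : vec3 R, f v <= c * expR (- (k * norm3 v ^+ 2)))
    (Bt_gt0 : 0 < Bt) (lambda_ge0 : 0 <= lambda) (lambda_le1 : lambda <= 1)
    (B_def : forall g chi : R, 0 <= g -> 0 <= chi -> chi <= pi ->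
      B g chi = g `^ lambda * Bt)
    (gtr_gt0 : 0 < gtr) :
  forall v : vec3 R,
    `| collision_operator B f v - truncated_collision_operator B f gtr v |
    <= c * expR (- (k * norm3 v ^+ 2))
       * relative_truncation_error Bt c k lambda gtr (norm3 v).
Proof.
move=> v; have [mf f0 _] := f_pdf.
pose W (g : vec3 R) : R := expR (- (k * norm3 (v + g) ^+ 2)) * norm3 g `^ lambda.
pose C : R := 4 * pi * c ^+ 2 * Bt * expR (- (k * norm3 v ^+ 2)).
pose rd (r : R) := radial_density k lambda (norm3 v) r.
have C0 : 0 <= C.
  by rewrite /C !mulr_ge0 ?expR_ge0 ?pi_ge0 ?sqr_ge0 ?ltW.
have W0 g : 0 <= W g by rewrite /W mulr_ge0 ?expR_ge0 ?powR_ge0.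
have mW : measurable_fun setT W.
  have mn : measurable_fun setT (fun g : vec3 R => norm3 (v + g)).
    by apply: (measurableT_comp (@measurable_norm3 R)); exact: measurable_vec3D.
  have me : measurable_fun [set: R] (fun r : R => expR (- (k * r ^+ 2))).
    apply: measurableT_comp => //; apply: measurableT_comp => //.
    by apply: measurable_funM => //; exact: measurable_funX.
  have mp : measurable_fun [set: R] (fun r : R => r `^ lambda) by exact: measurable_powR.
  apply: measurable_funM; first exact: (measurableT_comp me mn).
  exact: (measurableT_comp mp (@measurable_norm3 R)).
have md := measurable_collision_density f B Bt lambda mf B_def v.
have d_le := collision_density_le f B c k Bt lambda mf f0 f_le Bt_gt0 B_def v.
set d := collision_density B f v in md d_le *.
have mrd : measurable_fun (`[0, +oo[%classic : set R) rd.
  by apply: measurable_radial_density => //; exact: norm3_ge0.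
have rd0 r : 0 <= r -> 0 <= rd r by apply: radial_density_ge0 => //; exact: norm3_ge0.
(* The radius [a] is left free: [a = -1] gives integrability over the whole space, [a = gtr] the
   truncation error. *)
have tail_d (a : R) : (\int[lebesgue3 R]_(g in [set g | (a < norm3 g)%R]) `|(d g)%:E| <=
    C%:E * ((4 * pi)%:E * \int[lebesgue_measure]_(r in `[0%R, +oo[ `&` `]a, +oo[) (rd r)%:E))%E.
  rewrite -integral_gaussian_tail//.
  have mA : measurable [set g : vec3 R | a < norm3 g].
    apply: measurable_set_bool; apply: measurable_fun_ltr => //.
    exact: measurable_norm3.
  rewrite -ge0_integralZl//; last 2 first.
  - by apply/measurable_EFinP; exact: measurable_funTS.
  - by move=> g _; rewrite lee_fin W0.
  apply: ge0_le_integral => //.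
  - by apply: measurableT_comp => //; apply/measurable_EFinP; exact: measurable_funTS.
  - by apply: measurable_funeM; apply/measurable_EFinP; exact: measurable_funTS.
  - by move=> g _; rewrite -EFinM lee_fin d_le.
have tail_lty (a : R) : (\int[lebesgue_measure]_(r in `[0%R, +oo[ `&` `]a, +oo[) (rd r)%:E < +oo)%E.
  apply: le_lt_trans (integral_radial_density_lty k lambda (norm3 v) k_gt0 lambda_ge0
    lambda_le1 (norm3_ge0 v)).
  apply: ge0_subset_integral => //.
  - by apply: measurableI; exact: measurable_itv.
  - exact/measurable_EFinP.
  - by move=> r; rewrite /= in_itv/= andbT lee_fin => /rd0.
(* Integrability permits splitting the collision operator into its truncated part and the integral
   over [A]. *)
have int_d : (lebesgue3 R).-integrable setT (EFin \o d).
  apply/integrableP; split; first exact/measurable_EFinP.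
  have -> : [set: vec3 R] = [set g : vec3 R | -1 < norm3 g].
    apply/seteqP; split => // g _ /=.
    by rewrite (lt_le_trans _ (norm3_ge0 g))// ltrN10.
  apply: (le_lt_trans (tail_d _)).
  apply: lte_mul_pinfty; rewrite ?lee_fin//.
  apply: lte_mul_pinfty; rewrite ?lee_fin//.
  by rewrite mulr_ge0// pi_ge0.
pose A := [set g : vec3 R | gtr < norm3 g].
pose A' := [set g : vec3 R | norm3 g <= gtr].
have mA : measurable A.
  apply: measurable_set_bool; apply: measurable_fun_ltr => //.
  exact: measurable_norm3.
have mA' : measurable A'.
  apply: measurable_set_bool; apply: measurable_fun_ler => //.
  exact: measurable_norm3.
have AA' : [set: vec3 R] = A' `|` A.
  by apply/seteqP; split => // g _; rewrite /A/A'/=; case: (leP (norm3 g) gtr); [left|right].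
have dAA' : [disjoint A' & A].
  by apply/disj_setPS => g; rewrite /A/A'/= => -[]; rewrite leNgt => /negP.
have -> : collision_operator B f v - truncated_collision_operator B f gtr v =
    \int[lebesgue3 R]_(g in A) d g.
  rewrite /collision_operator /truncated_collision_operator -/d -/A' AA'.
  by rewrite Rintegral_setU// -?AA'// addrC addKr.
have int_dA : (lebesgue3 R).-integrable A (EFin \o d) by exact: integrableS int_d.
rewrite -lee_fin EFin_normr_Rintegral//.
apply: (le_trans (le_abse_integral _ mA (measurable_int _ int_dA))).
apply: (le_trans (tail_d gtr)).
(* Since [gtr] is positive, the constraint [0 <= r] is automatic beyond it. *)
have half_line : `[0%R, +oo[ `&` `]gtr, +oo[ = `]gtr, +oo[%classic :> set R.
  apply/seteqP; split => r /=; rewrite !in_itv/= !andbT; first by case.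
  by move=> gr; split => //; exact: (ltW (lt_trans gtr_gt0 gr)).
(* The radial integral is finite, so it agrees with the real-valued one in
   [relative_truncation_error]. *)
have tail_gtr : (\int[lebesgue_measure]_(r in `]gtr, +oo[) (rd r)%:E)%E =
    (\int[lebesgue_measure]_(r in `]gtr, +oo[) rd r)%:E.
  rewrite fineK// ge0_fin_numE.
    by have := tail_lty gtr; rewrite half_line.
  apply: integral_ge0 => r; rewrite /= in_itv/= andbT lee_fin => gr.
  exact/rd0/ltW/(lt_trans gtr_gt0).
rewrite half_line tail_gtr -!EFinM lee_fin /C /relative_truncation_error -/(rd _).
(* The constants agree exactly: the area of the sphere and the factor of [integral_gaussian_tail],
   both [4 * pi], multiply to [16 * pi ^+ 2], and one of the two factors [c] stands in front. *)
rewrite le_eqVlt; apply/orP; left; apply/eqP.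
rewrite -[\int[lebesgue_measure]_(g in _) _]/(\int[lebesgue_measure]_(r in `]gtr, +oo[) rd r).
by move: (Rintegral _ _ _) (expR _) => x y; ring.
Qed.
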